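(* Let $\alpha,\beta\ge\tfrac12$ and let $w(z)=(1-z)^{\beta-1}(1+z)^{\alpha-1}$ on $[-1,1]$, with orthonormal polynomials $\phi_k$, $k\ge0$. Then there is a constant $C$, independent of $n$, such that for all $n\ge 1$ $$L(n)=\max_{0\le k\le n}\ \sup_{z\in[-1,1]}(n+1)\,\lambda_{n+1}(z)\,\phi_k^2(z)\le C .$$
   Context: $\phi_k$ is the degree-$k$ polynomial with $\int_{-1}^{1}\phi_k\phi_\ell\,w\,dz=\delta_{k\ell}$ (normalizing $w$ to a probability density does not affect $L(n)$). The Christoffel function is $\lambda_{n+1}(z)=1/\sum_{k=0}^{n}\phi_k^2(z)$. *)

(* Defs.v *)
From HB Require Import structures.
From mathcomp Require Import all_boot all_order all_algebra.
From mathcomp Require Import all_classical all_reals all_analysis.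
Set Implicit Arguments.
Unset Strict Implicit.
Unset Printing Implicit Defensive.
Import Order.TTheory GRing.Theory Num.Theory.
Import numFieldNormedType.Exports.
Local Open Scope classical_set_scope.
Local Open Scope ring_scope.

(* [powR] takes the value 0 at base 0 with a negative exponent, so the weight
   is 0 instead of +oo at a singular endpoint; this is a null set. *)
Definition jacobi_weight (R : realType) (alpha beta z : R) : R :=
  (1 - z) `^ (beta - 1) * (1 + z) `^ (alpha - 1).

(* The polynomials are determined up to sign; [size p] is 1 + degree. The
   integral is extended-real valued, so equality with a finite value includes
   integrability. *)
Definition orthonormal_polys (R : realType) (w : R -> R)
    (phi : nat -> {poly R}) : Prop :=
  (forall k, size (phi k) = k.+1) /\
  (forall k l,
     (\int[lebesgue_measure]_(z in `[(-1)%R, 1%R])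
        ((phi k).[z] * (phi l).[z] * w z)%:E = ((k == l)%:R)%:E)%E).

Definition christoffel (R : realType) (phi : nat -> {poly R}) (m : nat)
    (z : R) : R :=
  1 / \sum_(k < m) (phi k).[z] ^+ 2.

(* The supremum is taken in the extended reals, so that an unbounded family
   gives +oo. *)
Definition Lmax (R : realType) (phi : nat -> {poly R}) (n : nat) : \bar R :=
  \big[maxe/-oo%E]_(k < n.+1)
    ereal_sup [set (n.+1%:R * christoffel phi n.+1 z * (phi k).[z] ^+ 2)%:E
              | z in `[(-1)%R, 1%R]].

(* Main.v *)
Require Import Defs.
From HB Require Import structures.
From mathcomp Require Import all_boot all_order all_algebra.
From mathcomp Require Import all_classical all_reals all_analysis.
From mathcomp Require Import measurable_realfun ring lra.
Import Order.TTheory GRing.Theory Num.Theory.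
Import numFieldNormedType.Exports.
Local Open Scope classical_set_scope.
Local Open Scope ring_scope.

(* By reflection it is enough to treat z in [0, 1]; put t = 1 - z. Pearson's
   equation for the weight makes the Jacobi differential operator symmetric, so
   the phi_k are its eigenfunctions, which gives phi_k'(1) and phi_k''(1) in
   terms of phi_k(1). The three-term recurrence and its first two derivatives at
   z = 1 then determine the recurrence coefficients, 1/2 + O(1/k^2) off the
   diagonal and O(1/k^2) on it, and the ratios phi_(k+1)(1) / phi_k(1).
   As long as k^2 t is small, the recurrence in discrete Sturm-Liouville form
   gives phi_k(1) / 2 <= phi_k(z) <= phi_k(1). For larger k the quadratic form
   phi_(k+1)^2 + phi_k^2 - 2 z phi_(k+1) phi_k is constant up to a bounded
   factor; it dominates t phi_k^2, and a telescoping identity bounds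
   t (phi_0^2 + ... + phi_n^2) from below by a multiple of n times it. *)

(** * Integration against the Jacobi weight *)

(** The difficulty is uniformity in t near 0. The quadratic form dominates only t phi_k^2, so
    coefficient errors O(1/k^2) cause a relative drift of order 1/(sqrt t k^2), whose sum over all k
    is unbounded as t tends to 0. Started at an index K of order 1/sqrt t, the sum is O(1/(K sqrt
    t)) = O(1); below K the comparison with the values at 1 takes over. A loss of 1/t instead of
    1/sqrt t would be fatal, which is why consecutive differences, bounded by the form with no
    factor t, are kept apart. Restricting to z >= 0, that is t <= 1, makes sin^2 theta = t (2 - t)
    comparable with t. The exponents matter at the endpoints: phi_k(1)^2 grows like k^(2 beta - 1),
    and early values are bounded by late ones because beta >= 1/2; reflection asks the same of
    alpha. The integral enters only through linearity, orthonormality and Pearson's identity; the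
    rest is algebra and estimates on recurrences. *)

(** The derivative is asked for only in the open interval, since the integrand may blow up at the
    ends when an exponent of the weight is negative. The running integral minus [F] has derivative
    zero inside, so the mean value theorem makes it constant. *)
Lemma integrable_FTC2 {R : realType} (F g : R -> R) (a b : R) : a < b ->
  {within `[a, b], continuous F} ->
  (forall x, x \in `]a, b[ -> is_derive x 1 F (g x)) ->
  {in `]a, b[, continuous g} ->
  (@lebesgue_measure R).-integrable `[a, b] (EFin \o g) ->
  \int[lebesgue_measure]_(x in `[a, b]) g x = F b - F a.
Proof.
move=> ab cF dF cg ig.
pose G x := \int[lebesgue_measure]_(y in `[a, x]) g y.
have cG : {within `[a, b], continuous G}.
  exact: (parameterized_integral_continuous (ltW ab) ig).
have dG x : x \in `]a, b[ -> is_derive x 1 G (g x).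
  move=> xab; have cgx : {for x, continuous g} by exact: cg.
  move: xab; rewrite in_itv/= => /andP[ax xb].
  have [d e] := continuous_FTC1_closed xb ig ax cgx.
  by apply: DeriveDef; rewrite -?derive1E.
have cGF : {within `[a, b], continuous (G - F)}.
  by move=> x; apply: continuousB; [exact: cG|exact: cF].
have dGF x : x \in `]a, b[ -> is_derive x 1 (G - F) (g x - g x).
  by move=> xab; apply: is_deriveB; [exact: dG|exact: dF].
have [c _] := MVT ab dGF cGF.
rewrite subrr mul0r => /eqP.
rewrite subr_eq0 => /eqP GF.
have Ga : G a = 0 by rewrite /G set_itv1 Rintegral_set1.
have : G b - F b = G a - F a by exact: GF.
rewrite Ga sub0r => h; rewrite -/(G b).
by rewrite -(subrK (F b) (G b)) h addrC.
Qed.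

Lemma cvg_powR_within {R : realType} (r : R) (f : R -> R) (F : set_system R)
    {FF : Filter F} :
  0 < r -> f x @[x --> F] --> 0 -> (\forall x \near F, 0 <= f x) ->
  f x `^ r @[x --> F] --> 0.
Proof.
move=> r0 f0 fp; apply/cvgrPdist_lt => e e0.
have : \forall x \near F, `|0 - f x| < e `^ (r^-1).
  by move/cvgrPdist_lt : f0; apply; exact: powR_gt0.
move=> h; near=> x; rewrite sub0r normrN ger0_norm ?powR_ge0//.
have fx0 : 0 <= f x by near: x.
have : `|0 - f x| < e `^ (r^-1) by near: x.
rewrite sub0r normrN ger0_norm// => h1.
have -> : e = (e `^ r^-1) `^ r by rewrite -powRrM mulVf ?gt_eqF// powRr1// ltW.
by apply: gt0_ltr_powR; rewrite ?nnegrE ?powR_ge0.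
Unshelve. all: by end_near. Qed.

Lemma horner_norm_le {R : realType} (p : {poly R}) (z : R) : `|z| <= 1 ->
  `|p.[z]| <= \sum_(i < size p) `|p`_i|.
Proof.
move=> z1; rewrite horner_coef; apply: le_trans (ler_norm_sum _ _ _) _.
apply: ler_sum => i _; rewrite normrM normrX ler_piMr// exprn_ile1//.
Qed.

Section JacobiFunctional.
Variables (R : realType) (alpha beta : R).
Hypotheses (alpha0 : 0 < alpha) (beta0 : 0 < beta).

Local Notation mu := (@lebesgue_measure R).
Local Notation w := (jacobi_weight alpha beta).
Local Notation I := (`[(-1)%R, 1%R]%classic : set R).

Lemma jacobi_weight_ge0 z : 0 <= w z.
Proof. by rewrite mulr_ge0 ?powR_ge0. Qed.

Lemma measurable_jacobi_weight : measurable_fun I w.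
Proof.
apply: measurable_funTS; apply: measurable_funM.
- apply: (measurableT_comp (measurable_powR _)); exact: measurable_funB.
- apply: (measurableT_comp (measurable_powR _)); exact: measurable_funD.
Qed.

(** No Beta integral is computed: [phi 0] is a nonzero constant, and its normalization already says
    that a positive multiple of the weight has integral 1. *)
Lemma integrable_jacobi_weight (phi : nat -> {poly R}) :
  orthonormal_polys w phi -> mu.-integrable I (EFin \o w).
Proof.
move=> [sz /(_ 0 0)].
have /size_poly1P[c c0 phi0] : size (phi 0) == 1 by rewrite sz.
rewrite phi0 eqxx => int1.
have mw := measurable_jacobi_weight.
have ic : mu.-integrable I (EFin \o (fun z => c ^+ 2 * w z)).
  apply/integrableP; split.
    by apply/measurable_EFinP; exact: measurable_funM.
  rewrite [X in (X < _)%E](_ : _ = 1%:E) ?ltry// -int1.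
  apply: eq_integral => z _ /=; rewrite !hornerC -expr2 ger0_norm//.
  by rewrite mulr_ge0 ?sqr_ge0 ?jacobi_weight_ge0.
have := integrableZl _ (c ^- 2) ic; move=> /(_ (measurable_itv _)).
apply: eq_integrable => [|z _ /=]; first exact: measurable_itv.
by rewrite -EFinM mulrA mulVf ?mul1r// expf_neq0.
Qed.

Hypothesis iw : mu.-integrable I (EFin \o w).

Lemma integrable_horner_jacobi p : mu.-integrable I (EFin \o (fun z => p.[z] * w z)).
Proof.
suff : mu.-integrable I ((EFin \o horner p) \* (EFin \o w))%E by [].
apply: integrableMr => //.
- by apply: measurable_funTS; apply: continuous_measurable_fun; exact: continuous_horner.
- exists (\sum_(i < size p) `|p`_i|); split; first by rewrite num_real.
  move=> M hM z /=; rewrite in_itv/= => zI.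
  by apply: le_trans (ltW hM); apply: horner_norm_le; rewrite ler_norml.
Qed.

Definition jacobi_functional (p : {poly R}) : R :=
  \int[mu]_(z in I) (p.[z] * w z).

Lemma jacobi_functional_linear a p q :
  jacobi_functional (a *: p + q) = a * jacobi_functional p + jacobi_functional q.
Proof.
rewrite /jacobi_functional -RintegralZl//; last exact: integrable_horner_jacobi.
rewrite -RintegralD//; last exact: integrable_horner_jacobi.
  by apply: eq_Rintegral => z _ /=; rewrite hornerD hornerZ; ring.
have := integrableZl _ a (integrable_horner_jacobi p).
by apply; exact: measurable_itv.
Qed.

(** Pearson's equation: with sigma = 1 - z^2, the product sigma w is (1 - z)^beta (1 + z)^alpha, and
    its derivative is w times a polynomial of degree at most one. *)
Lemma is_derive_jacobi_primitive (r : {poly R}) (x : R) : -1 < x < 1 ->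
  is_derive x 1 (fun z : R => (1 - z) `^ beta * (1 + z) `^ alpha * r.[z])
    ((((alpha - beta)%:P - (alpha + beta) *: 'X) * r
                     + (1 - 'X ^+ 2) * r^`()).[x] * w x).
Proof.
move=> /andP[x1 x2].
have p1 : 0 < 1 - x by lra.
have p2 : 0 < 1 + x by lra.
have d1 : is_derive x 1 (fun z : R => (1 - z) `^ beta)
    (- (beta * (1 - x) `^ (beta - 1))).
  have dm : is_derive x 1 (fun z : R => 1 - z) (-1).
    by apply: is_derive_eq; ring.
  apply: is_derive_eq.
    by apply: (@is_derive1_comp _ (fun y : R => y `^ beta) (fun z : R => 1 - z));
      exact: is_derive1_powR.
  by rewrite /= mulrN1.
have d2 : is_derive x 1 (fun z : R => (1 + z) `^ alpha)
    (alpha * (1 + x) `^ (alpha - 1)).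
  have dm : is_derive x 1 (fun z : R => 1 + z) 1.
    by apply: is_derive_eq; ring.
  apply: is_derive_eq.
    by apply: (@is_derive1_comp _ (fun y : R => y `^ alpha) (fun z : R => 1 + z));
      exact: is_derive1_powR.
  by rewrite /= mulr1.
apply: is_derive_eq => /=.
rewrite /GRing.scale/= !hornerE /jacobi_weight.
rewrite -(mulr_powRB1 (ltW p1) beta0) -(mulr_powRB1 (ltW p2) alpha0).
by rewrite /=; ring.
Qed.

Lemma continuous_powR_onem (r x : R) : x < 1 ->
  {for x, continuous (fun z : R => (1 - z) `^ r)}.
Proof.
move=> x1; apply: (@continuous_comp _ _ _ (fun z : R => 1 - z) (fun y : R => y `^ r)).
  by apply: continuousB => //; exact: cvg_cst.
apply: differentiable_continuous; apply/derivable1_diffP.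
by apply: ex_derive; apply: is_derive1_powR; rewrite subr_gt0.
Qed.

Lemma continuous_powR_onep (r x : R) : -1 < x ->
  {for x, continuous (fun z : R => (1 + z) `^ r)}.
Proof.
move=> x1; apply: (@continuous_comp _ _ _ (fun z : R => 1 + z) (fun y : R => y `^ r)).
  by apply: continuousD => //; exact: cvg_cst.
apply: differentiable_continuous; apply/derivable1_diffP.
by apply: ex_derive; apply: is_derive1_powR; lra.
Qed.

(** The integrand is an exact derivative, and its primitive vanishes at both ends because [alpha]
    and [beta] are positive. *)
Lemma jacobi_functional_pearson r :
  jacobi_functional (((alpha - beta)%:P - (alpha + beta) *: 'X) * r
                     + (1 - 'X ^+ 2) * r^`()) = 0.
Proof.
pose F z : R := (1 - z) `^ beta * (1 + z) `^ alpha * r.[z].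
have E0 : 1 + -1 = 0 :> R by lra.
have E1 : -1 < 1 :> R by lra.
have Fs : F 1 = 0 by rewrite /F E0 powR0 ?gt_eqF// !mul0r.
have Fm : F (- 1) = 0 by rewrite /F E0 (powR0 (x := alpha)) ?gt_eqF// mulr0 mul0r.
transitivity (F 1 - F (-1)); last by rewrite Fs Fm subrr.
apply: integrable_FTC2 => //.
- apply/continuous_within_itvP => //; split.
  + move=> x; rewrite in_itv/= => xI.
    apply: differentiable_continuous; apply/derivable1_diffP.
    by have [] := is_derive_jacobi_primitive r x xI.
  + rewrite Fm (_ : 0 = (1 - -1) `^ beta * 0 * r.[-1]); last by rewrite mulr0 mul0r.
    apply: cvgM; last first.
      by apply: cvg_at_right_filter; exact: continuous_horner.
    apply: cvgM; first by apply: cvg_at_right_filter; exact: continuous_powR_onem.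
    apply: cvg_powR_within => //.
      rewrite -E0; apply: cvg_at_right_filter.
      by apply: cvgD; [exact: cvg_cst|exact: cvg_id].
    near=> z; rewrite -lerBlDl sub0r; near: z; exact: nbhs_right_ge.
  + rewrite Fs (_ : 0 = 0 * (1 + 1) `^ alpha * r.[1]); last by rewrite !mul0r.
    apply: cvgM; last first.
      by apply: cvg_at_left_filter; exact: continuous_horner.
    apply: cvgM; last by apply: cvg_at_left_filter; exact: continuous_powR_onep.
    apply: cvg_powR_within => //.
      rewrite -E0; apply: cvg_at_left_filter.
      by apply: cvgB; [exact: cvg_cst|exact: cvg_id].
    near=> z; rewrite subr_ge0; near: z; exact: nbhs_left_le.
- by move=> x; rewrite in_itv/=; exact: is_derive_jacobi_primitive.
- move=> x; rewrite in_itv/= => /andP[x1 x2].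
  apply: cvgM; first exact: continuous_horner.
  by apply: cvgM; [exact: continuous_powR_onem|exact: continuous_powR_onep].
- exact: integrable_horner_jacobi.
Unshelve. all: by end_near. Qed.
End JacobiFunctional.

(** * Orthonormal polynomials of a linear functional *)

Section OrthonormalExpansion.
Variables (R : fieldType) (l : {poly R} -> R) (phi : nat -> {poly R}).
Hypothesis l_lin : forall a p q, l (a *: p + q) = a * l p + l q.
Hypothesis size_phi : forall k, size (phi k) = k.+1.
Hypothesis ortho : forall i j, l (phi i * phi j) = (i == j)%:R.

Lemma functional0 : l 0 = 0.
Proof.
have := l_lin 1 0 0; rewrite scaler0 addr0 mul1r => h.
by apply: (addrI (l 0)); rewrite addr0.
Qed.

Lemma functionalZ a p : l (a *: p) = a * l p.
Proof. by rewrite -[a *: p]addr0 l_lin functional0 addr0. Qed.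

Lemma functionalD p q : l (p + q) = l p + l q.
Proof. by rewrite -[p]scale1r l_lin mul1r scale1r. Qed.

Lemma functional_sum (I : Type) (r : seq I) (P : pred I) (F : I -> {poly R}) :
  l (\sum_(i <- r | P i) F i) = \sum_(i <- r | P i) l (F i).
Proof. exact: (big_morph l functionalD functional0). Qed.

(** Induction on the size: subtracting the multiple of [phi n] that cancels the coefficient of
    degree [n] leaves a smaller polynomial, and orthonormality then identifies the coefficients. *)
Lemma orthonormal_expansion n (p : {poly R}) : (size p <= n)%N ->
  p = \sum_(j < n) l (p * phi j) *: phi j.
Proof.
elim: n p => [|n IH] p sp.
  by rewrite big_ord0; apply/eqP; rewrite -size_poly_leq0.
pose c := p`_n / lead_coef (phi n).
have lc0 : lead_coef (phi n) != 0.
  by rewrite lead_coef_eq0 -size_poly_eq0 size_phi.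
pose q := p - c *: phi n.
have sq : (size q <= n)%N.
  apply/leq_sizeP => i; rewrite leq_eqVlt => /predU1P[<-|ni].
    by rewrite coefB coefZ /c -[(phi n)`_n]/((phi n)`_(n.+1.-1)) -size_phi divfK ?subrr.
  by rewrite coefB coefZ !nth_default ?mulr0 ?subrr// ?size_phi// (leq_trans sp).
have pq : p = q + c *: phi n by rewrite subrK.
have lq j : l (p * phi j) = l (q * phi j) + c * (n == j)%:R.
  by rewrite pq mulrDl functionalD -scalerAl functionalZ ortho.
have lqn : l (q * phi n) = 0.
  rewrite (IH _ sq) mulr_suml functional_sum big1// => j _.
  by rewrite -scalerAl functionalZ ortho ltn_eqF ?mulr0.
rewrite big_ord_recr/= lq lqn eqxx add0r mulr1 {1}pq; congr (_ + _).
rewrite {1}(IH _ sq); apply: eq_bigr => j _.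
by rewrite lq gtn_eqF ?mulr0 ?addr0.
Qed.

Lemma orthonormal_low (q : {poly R}) k : (size q <= k)%N -> l (q * phi k) = 0.
Proof.
move=> sq; rewrite (orthonormal_expansion _ _ sq) mulr_suml functional_sum big1// => j _.
by rewrite -scalerAl functionalZ ortho ltn_eqF ?mulr0.
Qed.

(** Entries of the Jacobi matrix, the tridiagonal matrix of multiplication by ['X] in the basis
    [phi]; later sections call them [b] and [a]. *)
Definition jacobi_diag k := l ('X * phi k * phi k).
Definition jacobi_offdiag k := l ('X * phi k * phi k.+1).

Lemma size_Xphi k : size ('X * phi k) = k.+2.
Proof. by rewrite mulrC size_mulX ?size_phi// -size_poly_eq0 size_phi. Qed.

Lemma three_term0 :
  'X * phi 0 = jacobi_offdiag 0 *: phi 1 + jacobi_diag 0 *: phi 0.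
Proof.
have /orthonormal_expansion {1}-> : (size ('X * phi 0)%R <= 2)%N by rewrite size_Xphi.
by rewrite !big_ord_recr big_ord0 /= add0r addrC.
Qed.

Lemma three_termS k :
  'X * phi k.+1 = jacobi_offdiag k.+1 *: phi k.+2 + jacobi_diag k.+1 *: phi k.+1
                  + jacobi_offdiag k *: phi k.
Proof.
have /orthonormal_expansion {1}-> : (size ('X * phi k.+1)%R <= k.+3)%N.
  by rewrite size_Xphi.
(* For j < k, moving ['X] onto [phi j] leaves a polynomial of degree below k + 1, to which
   [phi k.+1] is orthogonal. *)
rewrite !big_ord_recr big1 /=; last first.
  move=> j _; rewrite -mulrA [phi _ * _]mulrC mulrA orthonormal_low ?scale0r//.
  by rewrite size_Xphi ltnS.
rewrite add0r -[RHS]addrC -!addrA; congr (_ *: _ + _); last by rewrite addrC.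
by rewrite /jacobi_offdiag -!mulrA [phi k * _]mulrC.
Qed.

End OrthonormalExpansion.

(** * The Jacobi differential operator and its eigenfunctions *)

(** This is p |-> (sigma w p')' / w with sigma = 1 - z^2, expanded by Pearson's equation so that the
    weight disappears. *)
Definition jacobi_operator (R : nzRingType) (alpha beta : R) (p : {poly R}) : {poly R} :=
  (1 - 'X ^+ 2) * p^`()^`() + ((alpha - beta)%:P - (alpha + beta) *: 'X) * p^`().

Section JacobiOperator.
Variables (R : fieldType) (alpha beta : R).
Local Notation L := (jacobi_operator R alpha beta).

(** Shows that the operator is triangular on monomials; the diagonal entry -i (i + alpha + beta - 1)
    is the future eigenvalue. *)
Lemma coef_jacobi_operator p i : (L p)`_i =
  p`_i.+2 * (i.+2%:R * i.+1%:R) + (alpha - beta) * p`_i.+1 * i.+1%:R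
  - (i%:R * (i%:R - 1) + (alpha + beta) * i%:R) * p`_i.
Proof.
rewrite /jacobi_operator mulrBl mul1r mulrBl -scalerAl mul_polyC.
rewrite !(coefD, coefB, coefN, coefZ) coefXnM [('X * _)`_i]coefXM.
case: i => [|[|i]] /=; rewrite !coef_deriv ?subn0 //.
- by ring.
- by ring.
- by rewrite !subSS subn0; ring.
Qed.

Lemma size_jacobi_operator p : (size (L p) <= size p)%N.
Proof.
apply/leq_sizeP => i p0; have p1 := leqW p0; have p2 := leqW p1.
by rewrite coef_jacobi_operator !nth_default// !(mul0r, mulr0) addr0 subrr.
Qed.

Variables (l : {poly R} -> R) (phi : nat -> {poly R}).
Hypothesis l_lin : forall a p q, l (a *: p + q) = a * l p + l q.
Hypothesis size_phi : forall k, size (phi k) = k.+1.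
Hypothesis ortho : forall i j, l (phi i * phi j) = (i == j)%:R.
Hypothesis pearson : forall r, l (((alpha - beta)%:P - (alpha + beta) *: 'X) * r
                                  + (1 - 'X ^+ 2) * r^`()) = 0.

(** Pearson's identity applied to p' q. The right-hand side is symmetric in p and q, hence so is the
    operator. *)
Lemma jacobi_operator_form p q : l (L p * q) = - l ((1 - 'X ^+ 2) * p^`() * q^`()).
Proof.
apply/eqP; rewrite -addr_eq0 -(functionalD _ _ l_lin) -(pearson (p^`() * q)).
rewrite derivM /jacobi_operator; apply/eqP; congr (l _); ring.
Qed.

Lemma jacobi_operator_sym p q : l (L p * q) = l (p * L q).
Proof.
rewrite [p * _]mulrC !jacobi_operator_form; congr (- l _).
by rewrite mulrAC.
Qed.

(** The image of [phi k] has degree at most k; by symmetry its components along [phi j], j < k,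
    vanish because the operator does not raise the degree of [phi j]. Leading coefficients give the
    eigenvalue. *)
Lemma jacobi_operator_eigen k :
  L (phi k) = - (k%:R * (k%:R + alpha + beta - 1)) *: phi k.
Proof.
have sL j : (size (L (phi j)) <= j.+1)%N.
  by rewrite -(size_phi j) size_jacobi_operator.
have Lc : L (phi k) = l (L (phi k) * phi k) *: phi k.
  rewrite {1}(orthonormal_expansion _ _ _ l_lin size_phi ortho _ _ (sL k)).
  rewrite big_ord_recr big1 /= ?add0r// => j _.
  rewrite jacobi_operator_sym mulrC (orthonormal_low _ _ _ l_lin size_phi ortho) ?scale0r//.
  by apply: leq_trans (sL j) _; exact: ltn_ord.
have lc0 : (phi k)`_k != 0.
  by rewrite -[k in _`_k]/(k.+1.-1) -(size_phi k) -lead_coefE lead_coef_eq0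
    -size_poly_eq0 size_phi.
rewrite Lc; congr (_ *: _); apply: (mulIf lc0).
rewrite -coefZ -Lc coef_jacobi_operator !(nth_default _ (n := _.+1)) ?size_phi//.
by rewrite !mul0r mulr0 mul0r add0r sub0r; ring.
Qed.
End JacobiOperator.

(** * Consequences of the differential equation at z = 1 *)

Section EndpointRecurrence.
Variables (R : fieldType) (alpha beta : R).
Local Notation L := (jacobi_operator R alpha beta).
Local Notation s := (alpha + beta - 1).

(** At 1 the factor of the second derivative vanishes, so the equation there determines p'(1) from
    p(1), and its derivative determines p''(1) from p'(1). *)
Lemma jacobi_eigen_endpoint (p : {poly R}) c : L p = - c *: p ->
  2 * beta * p^`().[1] = c * p.[1] /\
  (2 * beta + 2) * p^`()^`().[1] = (c - (s + 1)) * p^`().[1].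
Proof.
move=> Lp; split.
  have := congr1 (horner^~ 1) Lp.
  rewrite /jacobi_operator /= !(hornerD, hornerM, hornerN, hornerC, hornerZ, hornerX).
  move=> h; have -> : c * p.[1] = - (- c * p.[1]) by ring.
  by rewrite -h; ring.
have := congr1 (fun q => q^`().[1]) Lp.
rewrite /jacobi_operator /= derivZ derivD !derivM !derivB !derivC derivZ derivX derivXn /=.
rewrite !(hornerD, hornerM, hornerN, hornerC, hornerZ, hornerX, horner0, hornerMn).
move=> h; have -> : (c - (s + 1)) * p^`().[1] = - (- c * p^`().[1]) - (s + 1) * p^`().[1] by ring.
by rewrite -h; ring.
Qed.

(* With [x = k], the eigenvalues attached to [q], [p], [r] are those of degrees
   [k + 1], [k], [k - 1]. The value at 1 of the recurrence and of its first two
   derivatives is a linear system in [a * q.[1]] and [c * r.[1]]. *)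
Lemma endpoint_recurrence (p q r : {poly R}) (a b c x : R) :
  L p = - (x * (x + s)) *: p ->
  L q = - ((x + 1) * (x + 1 + s)) *: q ->
  L r = - ((x - 1) * (x - 1 + s)) *: r ->
  'X * p = a *: q + b *: p + c *: r ->
  a * (2 * x + 1 + s) * q.[1] - c * (2 * x - 1 + s) * r.[1] = 2 * beta * p.[1] /\
  a * (2 * x + 1 + s) * (4 * x + 2 * s) * q.[1] = 4 * (x + s) * (x + beta) * p.[1].
Proof.
move=> /jacobi_eigen_endpoint[p1 p2] /jacobi_eigen_endpoint[q1 q2].
move=> /jacobi_eigen_endpoint[r1 r2] rec.
have h0 := congr1 (horner^~ 1) rec.
have h1 := congr1 (fun q => q^`().[1]) rec.
have h2 := congr1 (fun q => q^`()^`().[1]) rec.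
move: h0 h1 h2 => /=; rewrite !(derivM, derivD, derivZ, derivX, mul1r).
rewrite !(hornerD, hornerM, hornerZ, hornerX) !mul1r => h0 h1 h2.
move: p1 p2 q1 q2 r1 r2 h0 h1 h2.
set P0 := p.[1]; set Q0 := q.[1]; set R0 := r.[1].
set P1 := p^`().[1]; set Q1 := q^`().[1]; set R1 := r^`().[1].
set P2 := p^`()^`().[1]; set Q2 := q^`()^`().[1]; set R2 := r^`()^`().[1].
move=> p1 p2 q1 q2 r1 r2 h0 h1 h2.
(* Differentiated recurrence times [2 * beta], minus the eigenvalue of [p] times the recurrence: the
   terms in [b] cancel and only differences of consecutive eigenvalues remain. *)
have X : a * (2 * x + 1 + s) * Q0 - c * (2 * x - 1 + s) * R0 = 2 * beta * P0.
  transitivity (2 * beta * (a * Q1 + b * P1 + c * R1) - x * (x + s) * (a * Q0 + b * P0 + c * R0)).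
    have -> : 2 * beta * (a * Q1 + b * P1 + c * R1) =
      a * (2 * beta * Q1) + b * (2 * beta * P1) + c * (2 * beta * R1) by ring.
    by rewrite p1 q1 r1; ring.
  rewrite -h0 -h1 mulrDr p1; ring.
split => //.
pose M y : R := (y - (s + 1)) * y.
have m2 y (U0 U1 U2 : R) : 2 * beta * U1 = y * U0 ->
    (2 * beta + 2) * U2 = (y - (s + 1)) * U1 ->
    (2 * beta + 2) * (2 * beta) * U2 = M y * U0.
  move=> e1 e2; have -> : (2 * beta + 2) * (2 * beta) * U2 =
    2 * beta * ((2 * beta + 2) * U2) by ring.
  by rewrite e2 mulrCA e1 /M mulrA.
have Y : a * Q0 * (M ((x + 1) * (x + 1 + s)) - M (x * (x + s)))
   - c * R0 * (M (x * (x + s)) - M ((x - 1) * (x - 1 + s))) =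
   4 * (beta + 1) * (x * (x + s)) * P0.
  transitivity ((2 * beta + 2) * (2 * beta) * (a * Q2 + b * P2 + c * R2)
    - M (x * (x + s)) * (a * Q0 + b * P0 + c * R0)).
    have -> : (2 * beta + 2) * (2 * beta) * (a * Q2 + b * P2 + c * R2) =
      a * ((2 * beta + 2) * (2 * beta) * Q2) + b * ((2 * beta + 2) * (2 * beta) * P2)
      + c * ((2 * beta + 2) * (2 * beta) * R2) by ring.
    by rewrite (m2 _ _ _ _ p1 p2) (m2 _ _ _ _ q1 q2) (m2 _ _ _ _ r1 r2); ring.
  rewrite -h0 -h2.
  have -> : (2 * beta + 2) * (2 * beta) * (P1 + (P1 + P2)) =
    (2 * beta + 2) * 2 * (2 * beta * P1) + (2 * beta + 2) * (2 * beta) * P2 by ring.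
  by rewrite (m2 _ _ _ _ p1 p2) p1; ring.
(* The factor of [X] is the sum of the eigenvalues of [p] and [r] minus s + 1, by which
   M-differences exceed eigenvalue differences; it eliminates the term in [c]. *)
transitivity (a * Q0 * (M ((x + 1) * (x + 1 + s)) - M (x * (x + s)))
   - c * R0 * (M (x * (x + s)) - M ((x - 1) * (x - 1 + s)))
   - (a * (2 * x + 1 + s) * Q0 - c * (2 * x - 1 + s) * R0)
     * (2 * (x * (x + s)) - (2 * x - 1 + s) - 1 - s)).
  by rewrite /M; ring.
by rewrite Y X; ring.
Qed.
End EndpointRecurrence.

(** * Recurrence coefficients and values at the endpoint *)

(** Telescoping: 1/(j+1)^2 <= 2 (1/(j+1) - 1/(j+2)), so exp(2e/(j+1)) majorizes the product of all
    later factors. *)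
Lemma drift_step {R : realType} (e : R) (j : nat) : 0 <= e ->
  (1 + e / j.+1%:R ^+ 2) * expR (2 * e / j.+2%:R) <= expR (2 * e / j.+1%:R).
Proof.
move=> e0; apply: (@le_trans _ _ (expR (e / j.+1%:R ^+ 2) * expR (2 * e / j.+2%:R))).
  by rewrite ler_pM2r ?expR_gt0// expR_ge1Dx.
rewrite -expRD ler_expR.
have -> : e / j.+1%:R ^+ 2 + 2 * e / j.+2%:R = e * ((j.+1%:R ^+ 2)^-1 + 2 * j.+2%:R^-1).
  by ring.
rewrite [2 * e]mulrC -mulrA ler_wpM2l//.
set x : R := j%:R; have x0 : 0 <= x by rewrite ler0n.
rewrite -(natr1 j.+1) -(natr1 j) -/x.
have -> : ((x + 1) ^+ 2)^-1 + 2 * (x + 1 + 1)^-1 =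
  2 * (x + 1)^-1 - x / ((x + 1) ^+ 2 * (x + 1 + 1)).
  by field; apply/andP; split; rewrite gt_eqF//; lra.
by rewrite gerBl divr_ge0// mulr_ge0 ?sqr_ge0//; lra.
Qed.

(** The loss depends on [e / K] only: [e] may be as large as 1/sqrt t provided the iteration starts
    at a [K] of that order. *)
Lemma le_expR_drift {R : realType} (x : nat -> R) (e : R) (K n : nat) :
  0 <= e -> (forall k, 0 <= x k) ->
  (forall k, (K <= k)%N -> x k <= x k.+1 * (1 + e / k.+1%:R ^+ 2)) ->
  (K <= n)%N -> x K <= x n * expR (2 * e / K.+1%:R).
Proof.
move=> e0 x0 step /subnK <-.
suff H m : x K * expR (2 * e / (m + K).+1%:R) <= x (m + K)%N * expR (2 * e / K.+1%:R).
  by apply: le_trans (H _); rewrite ler_peMr// -expR0 ler_expR divr_ge0 ?mulr_ge0.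
elim: m => [|m IH]; first by rewrite add0n.
have E0 : 0 < 1 + e / (m + K).+1%:R ^+ 2.
  by rewrite ltr_pwDl// divr_ge0 ?sqr_ge0.
rewrite -(ler_pM2l E0) mulrCA.
apply: (@le_trans _ _ (x K * expR (2 * e / (m + K).+1%:R))).
  by rewrite ler_wpM2l// addSn drift_step.
apply: (le_trans IH); rewrite mulrA [_ * x _]mulrC ler_pM2r ?expR_gt0//.
by rewrite addSn step// leq_addl.
Qed.

Lemma expR_drift {R : realType} (x : nat -> R) (e : R) (K n : nat) :
  0 <= e -> (forall k, 0 <= x k) ->
  (forall k, (K <= k)%N -> x k.+1 <= x k * (1 + e / k.+1%:R ^+ 2)) ->
  (K <= n)%N -> x n <= x K * expR (2 * e / K.+1%:R).
Proof.
move=> e0 x0 step /subnK <-.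
suff H m : x (m + K)%N * expR (2 * e / (m + K).+1%:R) <= x K * expR (2 * e / K.+1%:R).
  by apply: le_trans (H (n - K)%N); rewrite ler_peMr// -expR0 ler_expR divr_ge0 ?mulr_ge0.
elim: m => [|m IH]; first by rewrite add0n.
apply: le_trans IH.
apply: (@le_trans _ _ (x (m + K)%N * (1 + e / (m + K).+1%:R ^+ 2) * expR (2 * e / (m + K).+2%:R))).
  by rewrite addSn ler_pM2r ?expR_gt0// step// leq_addl.
by rewrite -mulrA ler_wpM2l// drift_step.
Qed.

Section EndpointAsymptotics.
Variables (R : realType) (alpha beta : R) (a b v : nat -> R).
Local Notation s := (alpha + beta - 1).
Hypotheses (halpha : 1 / 2 <= alpha) (hbeta : 1 / 2 <= beta).
Hypothesis v_gt0 : forall k, 0 < v k.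
Hypothesis slope0 : a 0 * (1 + s) * v 1 = 2 * beta * v 0.
Hypothesis slopeS : forall k,
  a k.+1 * (2 * k%:R + 3 + s) * v k.+2 - a k * (2 * k%:R + 1 + s) * v k
  = 2 * beta * v k.+1.
Hypothesis ratio : forall k,
  a k * (2 * k%:R + 1 + s) * (2 * k%:R + s) * v k.+1
  = 2 * (k%:R + s) * (k%:R + beta) * v k.
Hypothesis value : forall k,
  v k.+1 = a k.+1 * v k.+2 + b k.+1 * v k.+1 + a k * v k.

Lemma jacobi_shift_ge0 : 0 <= s.
Proof. by have ha := halpha; have hb := hbeta; lra. Qed.

(** [ratio] at k + 1 and [slopeS] at k eliminate v_(k+2). Multiplied by [ratio] this gives a_k^2;
    divided into it, the square of v_(k+1) / v_k. *)
Lemma ratio_back k :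
  a k * (2 * k%:R + 1 + s) * (2 * k%:R + 2 + s) * v k
  = 2 * (k%:R + 1) * (k%:R + alpha) * v k.+1.
Proof.
have := ratio k.+1; have := slopeS k; rewrite -(natr1 k) => h1 h2.
have e : a k * (2 * k%:R + 1 + s) * v k =
    a k.+1 * (2 * k%:R + 3 + s) * v k.+2 - 2 * beta * v k.+1 by rewrite -h1; ring.
transitivity ((2 * k%:R + 2 + s) * (a k * (2 * k%:R + 1 + s) * v k)); first by ring.
rewrite e mulrBr; transitivity (a k.+1 * (2 * (k%:R + 1) + 1 + s) * (2 * (k%:R + 1) + s)
  * v k.+2 - (2 * k%:R + 2 + s) * (2 * beta * v k.+1)); first by ring.
by rewrite h2; ring.
Qed.

(** Read off [ratio_back], since [ratio] degenerates to 0 = 0 at k = 0 when alpha = beta = 1/2. *)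
Lemma offdiag_gt0 k : 0 < a k.
Proof.
have s0 := jacobi_shift_ge0; have ha := halpha; have hb := hbeta; have v0 := v_gt0 k; have v1 := v_gt0 k.+1.
have n0 : 0 <= k%:R :> R by [].
have h := ratio_back k.
have : 0 < a k * ((2 * k%:R + 1 + s) * (2 * k%:R + 2 + s) * v k).
  by rewrite !mulrA h !mulr_gt0//; lra.
by rewrite pmulr_lgt0// !mulr_gt0//; lra.
Qed.

Lemma offdiag_sqr k : let N := 2 * k%:R + 1 + s in
  4 * a k ^+ 2 * N ^+ 2 * (N ^+ 2 - 1) =
  (N ^+ 2 - (1 - s) ^+ 2) * (N ^+ 2 - (alpha - beta) ^+ 2).
Proof.
move=> N; have v0 := v_gt0 k; have v1 := v_gt0 k.+1.
have vv : v k.+1 * v k != 0 by rewrite gt_eqF// mulr_gt0.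
apply: (mulIf vv).
transitivity (4 * (a k * (2 * k%:R + 1 + s) * (2 * k%:R + s) * v k.+1) *
  (a k * (2 * k%:R + 1 + s) * (2 * k%:R + 2 + s) * v k)); first by rewrite /N; ring.
by rewrite ratio ratio_back /N; ring.
Qed.

Lemma offdiag_asymp : exists2 c : R, 0 <= c &
  forall k, (1 <= k)%N -> `|1 - 2 * a k| <= c / k.+1%:R ^+ 2.
Proof.
have s0 := jacobi_shift_ge0; have ha := halpha; have hb := hbeta.
(* By [key] below, 1 - 4 a_k^2 is at most N^2 c / (N^2 (N^2 - 1)) in absolute value; the factor 2
   absorbs N^2 <= 2 (N^2 - 1), true because k >= 1 gives N >= 3. *)
pose c : R := (1 + (1 - s) ^+ 2) * (1 + (alpha - beta) ^+ 2).
have c0 : 0 <= c by rewrite mulr_ge0// addr_ge0 ?sqr_ge0.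
exists (2 * c) => [|k k1]; first by rewrite mulr_ge0.
have a0 := offdiag_gt0 k; have := offdiag_sqr k.
have k1R : 1 <= k%:R :> R by rewrite ler1n.
rewrite -(natr1 k); set x : R := k%:R in k1R *; set N : R := (2 * x + 1 + s) => /= h.
have N3 : 3 <= N by rewrite /N; lra.
have xN : x + 1 <= N by rewrite /N; lra.
have x2N : (x + 1) ^+ 2 <= N ^+ 2 by rewrite ler_sqr ?nnegrE//; lra.
have N2 : 9 <= N ^+ 2 by nra.
have X2 : 0 < (x + 1) ^+ 2 by rewrite exprn_gt0//; lra.
have step1 : `|1 - 2 * a k| <= `|1 - 4 * a k ^+ 2|.
  have -> : 1 - 4 * a k ^+ 2 = (1 - 2 * a k) * (1 + 2 * a k) by ring.
  by rewrite normrM ler_peMr// ger0_norm; lra.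
apply: le_trans step1 _; rewrite ler_pdivlMr//.
have D0 : 0 < N ^+ 2 * (N ^+ 2 - 1) by rewrite mulr_gt0//; lra.
have key : (1 - 4 * a k ^+ 2) * (N ^+ 2 * (N ^+ 2 - 1)) =
   - (N ^+ 2 * (1 - (1 - s) ^+ 2 - (alpha - beta) ^+ 2)
      + (1 - s) ^+ 2 * (alpha - beta) ^+ 2).
  transitivity (N ^+ 2 * (N ^+ 2 - 1) - 4 * a k ^+ 2 * N ^+ 2 * (N ^+ 2 - 1)).
    by ring.
  by rewrite h; ring.
rewrite -(ler_pM2r D0) mulrAC -{1}(gtr0_norm D0) -normrM key normrN.
have u0 : 0 <= (1 - s) ^+ 2 by exact: sqr_ge0.
have w0 : 0 <= (alpha - beta) ^+ 2 by exact: sqr_ge0.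
have B : `|N ^+ 2 * (1 - (1 - s) ^+ 2 - (alpha - beta) ^+ 2)
      + (1 - s) ^+ 2 * (alpha - beta) ^+ 2| <= N ^+ 2 * c.
  rewrite /c; move: u0 w0; set u := (1 - s) ^+ 2; set w := (alpha - beta) ^+ 2 => u0 w0.
  have uw : 0 <= u * w by rewrite mulr_ge0.
  have uwN : u * w <= N ^+ 2 * (u * w) by rewrite ler_peMl//; lra.
  have Nu : 0 <= N ^+ 2 * u by rewrite mulr_ge0//; lra.
  have Nw : 0 <= N ^+ 2 * w by rewrite mulr_ge0//; lra.
  by rewrite ler_norml; apply/andP; split; lra.
apply: (@le_trans _ _ (N ^+ 2 * c * N ^+ 2)).
  by apply: ler_pM => //; rewrite ltW.
have -> : 2 * c * (N ^+ 2 * (N ^+ 2 - 1)) = N ^+ 2 * c * (2 * (N ^+ 2 - 1)) by ring.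
by rewrite ler_wpM2l ?mulr_ge0//; lra.
Qed.

(** The recurrence at 1 expresses b_(k+1) through a_(k+1) v_(k+2) / v_(k+1) and a_k v_k / v_(k+1),
    both known explicitly. *)
Lemma diag_eq k : b k.+1 =
  (alpha - beta) * (s - 1) / ((2 * k%:R + 1 + s) * (2 * k%:R + 3 + s)).
Proof.
have s0 := jacobi_shift_ge0; have ha := halpha; have hb := hbeta; have n0 : 0 <= k%:R :> R by [].
have v1 := v_gt0 k.+1.
have v10 : v k.+1 != 0 by rewrite gt_eqF.
have d1 : 2 * k%:R + 1 + s != 0 by rewrite gt_eqF//; lra.
have d2 : 2 * k%:R + 2 + s != 0 by rewrite gt_eqF//; lra.
have d3 : 2 * k%:R + 3 + s != 0 by rewrite gt_eqF//; lra.
have r1 : a k.+1 * v k.+2 = 2 * (k%:R + 1 + s) * (k%:R + 1 + beta)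
    / ((2 * k%:R + 3 + s) * (2 * k%:R + 2 + s)) * v k.+1.
  have := ratio k.+1; rewrite -(natr1 k) => h.
  have d : (2 * k%:R + 3 + s) * (2 * k%:R + 2 + s) != 0 by rewrite mulf_neq0.
  apply: (mulfI d); transitivity (a k.+1 * (2 * (k%:R + 1) + 1 + s) * (2 * (k%:R + 1) + s)
    * v k.+2); first by ring.
  rewrite h; field; exact/andP.
have r2 : a k * v k = 2 * (k%:R + 1) * (k%:R + alpha)
    / ((2 * k%:R + 1 + s) * (2 * k%:R + 2 + s)) * v k.+1.
  have d : (2 * k%:R + 1 + s) * (2 * k%:R + 2 + s) != 0 by rewrite mulf_neq0.
  apply: (mulfI d); transitivity (a k * (2 * k%:R + 1 + s) * (2 * k%:R + 2 + s) * v k).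
    by ring.
  rewrite ratio_back; field; exact/andP.
apply: (mulIf v10).
have -> : b k.+1 * v k.+1 = v k.+1 - a k.+1 * v k.+2 - a k * v k.
  by rewrite [X in X - _ - _]value; ring.
by rewrite r1 r2; field; rewrite d1 d2 d3.
Qed.

Lemma diag_asymp : exists2 c : R, 0 <= c &
  forall k, (1 <= k)%N -> `|2 * b k| <= c / k.+1%:R ^+ 2.
Proof.
have s0 := jacobi_shift_ge0; have ha := halpha; have hb := hbeta.
pose c : R := `|(alpha - beta) * (s - 1)|.
exists (4 * c) => [|[//|k] _]; first by rewrite mulr_ge0 ?normr_ge0.
have n0 : 0 <= k%:R :> R by [].
rewrite -(natr1 k.+1) -(natr1 k) diag_eq; set x : R := k%:R in n0 *.
rewrite mulrA normrM normfV normrM (ger0_norm (ler0n _ 2)) -/c.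
have D0 : 0 < (2 * x + 1 + s) * (2 * x + 3 + s) by rewrite mulr_gt0//; lra.
have X0 : 0 < (x + 1 + 1) ^+ 2 by rewrite exprn_gt0//; lra.
rewrite (gtr0_norm D0) ler_pdivrMr// mulrAC ler_pdivlMr//.
have -> : 4 * c * ((2 * x + 1 + s) * (2 * x + 3 + s)) =
  2 * c * (2 * ((2 * x + 1 + s) * (2 * x + 3 + s))) by ring.
rewrite ler_wpM2l ?mulr_ge0 ?normr_ge0//; nra.
Qed.

Let num k := (k%:R + s) * (k%:R + beta) * (2 * k%:R + 2 + s).
Let den k := (k%:R + 1) * (k%:R + alpha) * (2 * k%:R + s).

Lemma sqr_ratio k : v k.+1 ^+ 2 * den k = v k ^+ 2 * num k.
Proof.
have s0 := jacobi_shift_ge0; have ha := halpha; have hb := hbeta; have n0 : 0 <= k%:R :> R by [].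
have two0 : 2 != 0 :> R by rewrite pnatr_eq0.
apply: (mulfI two0).
transitivity ((2 * k%:R + s) * v k.+1 * (2 * (k%:R + 1) * (k%:R + alpha) * v k.+1)).
  by rewrite /den; ring.
rewrite -ratio_back.
transitivity ((2 * k%:R + 2 + s) * v k * (a k * (2 * k%:R + 1 + s) * (2 * k%:R + s) * v k.+1)).
  by ring.
by rewrite ratio /num; ring.
Qed.

(** The coefficient 4 beta - 2 >= 0 decides the growth: v_(k+1)^2 / v_k^2 is about 1 + (2 beta - 1)
    / k. *)
Lemma num_sub_den k : num k - den k =
  (4 * beta - 2) * (k%:R ^+ 2 + (1 + s) * k%:R) + s * (2 * beta + s * beta - alpha).
Proof. by rewrite /num /den; ring. Qed.

Lemma endpoint_increment : exists2 c : R, 0 <= c &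
  forall k, (1 <= k)%N -> `|v k.+1 - v k| <= c * v k / k.+1%:R.
Proof.
have s0 := jacobi_shift_ge0; have ha := halpha; have hb := hbeta.
pose c : R := (4 * beta - 2) * (2 + s) + s * `|2 * beta + s * beta - alpha|.
have c0 : 0 <= c by rewrite addr_ge0// mulr_ge0//; lra.
exists c => // k k1; have v0 := v_gt0 k; have v1 := v_gt0 k.+1.
have k1R : 1 <= k%:R :> R by rewrite ler1n.
have h := sqr_ratio k.
have kk : k%:R <= k%:R ^+ 2 :> R by rewrite expr2 ler_peMl.
have skk : s * k%:R <= s * k%:R ^+ 2 by rewrite ler_wpM2l.
have D : `|num k - den k| <= c * k%:R ^+ 2.
  rewrite num_sub_den; apply: le_trans (ler_normD _ _) _.
  rewrite normrM ger0_norm; last by lra.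
  rewrite normrM (ger0_norm s0) ger0_norm; last by rewrite addr_ge0 ?sqr_ge0// mulr_ge0//; lra.
  have -> : c * k%:R ^+ 2 = (4 * beta - 2) * (2 + s) * k%:R ^+ 2 +
      s * `|2 * beta + s * beta - alpha| * k%:R ^+ 2 by rewrite /c; ring.
  rewrite lerD//.
    by rewrite -[leRHS]mulrA ler_wpM2l//; lra.
  by rewrite ler_peMr ?mulr_ge0//; lra.
have den0 : (k%:R + 1) * k%:R ^+ 2 <= den k.
  by rewrite /den expr2 !mulrA; apply: ler_pM; nra.
have dp : 0 < den k.
  by apply: lt_le_trans den0; rewrite mulr_gt0 ?exprn_gt0//; lra.
rewrite -(natr1 k) ler_pdivlMr; last by lra.
have e : (v k.+1 - v k) * ((v k.+1 + v k) * den k) = v k ^+ 2 * (num k - den k).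
  by rewrite mulrBr -h; ring.
have q0 : 0 < (v k.+1 + v k) * den k by rewrite mulr_gt0//; lra.
rewrite -(ler_pM2r q0) mulrAC -{1}(gtr0_norm q0) -normrM e normrM.
rewrite ger0_norm ?sqr_ge0//.
apply: (@le_trans _ _ (v k ^+ 2 * (c * k%:R ^+ 2) * (k%:R + 1))).
  by rewrite ler_wpM2r ?ler_wpM2l ?sqr_ge0//; lra.
have -> : v k ^+ 2 * (c * k%:R ^+ 2) * (k%:R + 1) =
  c * v k * (v k * ((k%:R + 1) * k%:R ^+ 2)) by ring.
rewrite ler_wpM2l ?mulr_ge0 ?(ltW v0)//.
by apply: ler_pM => //; lra.
Qed.

(* Here [beta >= 1/2] enters: up to a summable relative error the values at 1
   are nondecreasing. *)
Lemma endpoint_almost_increasing : exists2 c : R, 0 < c &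
  forall k n, (k <= n)%N -> v k ^+ 2 <= c * v n ^+ 2.
Proof.
have s0 := jacobi_shift_ge0; have ha := halpha; have hb := hbeta.
(* The term -s alpha is the only possibly negative one in [num k - den k]. *)
have [e eE] : exists e, e = s * alpha by exists (s * alpha).
have e0 : 0 <= e by rewrite eE mulr_ge0//; lra.
have step k : (1 <= k)%N -> v k ^+ 2 <= v k.+1 ^+ 2 * (1 + e / k.+1%:R ^+ 2).
  move=> k1; have k1R : 1 <= k%:R :> R by rewrite ler1n.
  have numge : (k%:R + 1) ^+ 2 <= num k.
    rewrite /num -mulrA -[leLHS]mul1r; apply: ler_pM; [lra|exact: sqr_ge0|lra|].
    have q : 0 <= (2 * beta - 1 + s) * k%:R by rewrite mulr_ge0//; lra.
    have q' : 0 <= beta * s by rewrite mulr_ge0//; lra.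
    have q'' : 0 <= k%:R ^+ 2 :> R by exact: sqr_ge0.
    by lra.
  have p0 : 0 < (k%:R + 1) ^+ 2 :> R by rewrite exprn_gt0//; lra.
  have np : 0 < num k by exact: lt_le_trans numge.
  rewrite -(ler_pM2r np) -sqr_ratio -[leRHS]mulrA ler_wpM2l ?sqr_ge0// -(natr1 k).
  have : den k <= num k + e.
    rewrite -subr_ge0 addrAC num_sub_den eE.
    have q1 : 0 <= (4 * beta - 2) * (k%:R ^+ 2 + (1 + s) * k%:R).
      apply: mulr_ge0; first by lra.
      by rewrite addr_ge0 ?sqr_ge0// mulr_ge0//; lra.
    have q2 : 0 <= s * beta by rewrite mulr_ge0//; lra.
    have q3 : 0 <= s * (2 * beta + s * beta) by rewrite mulr_ge0//; lra.
    by lra.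
  move=> /le_trans; apply; rewrite mulrDl mul1r lerD2l.
  by rewrite mulrAC ler_pdivlMr// ler_wpM2l.
pose c1 := expR (2 * e / 2%:R).
have c1_ge1 : 1 <= c1 by rewrite /c1 -[leLHS]expR0 ler_expR divr_ge0 ?mulr_ge0.
have H k n : (1 <= k)%N -> (k <= n)%N -> v k ^+ 2 <= c1 * v n ^+ 2.
  move=> k1 kn; have := le_expR_drift (fun j => v j ^+ 2) e k n e0.
  move=> /(_ (fun j => sqr_ge0 _)) /(_ (fun j kj => step j (leq_trans k1 kj)) kn).
  move=> /le_trans; apply; rewrite mulrC ler_wpM2r ?sqr_ge0// ler_expR.
  by rewrite ler_wpM2l ?mulr_ge0// lef_pV2 ?posrE// ler_nat ltnS.
(* Index 0 is compared with index 1 by hand, as the step above needs k >= 1. *)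
pose c0 := v 0 ^+ 2 / v 1 ^+ 2.
have c0p : 0 < c0 by rewrite divr_gt0 ?exprn_gt0.
exists (c1 * (1 + c0)) => [|[|k] n kn]; first by rewrite mulr_gt0//; lra.
- case: n kn => [_|n _].
    by rewrite ler_peMl ?sqr_ge0// mulr_ege1//; lra.
  have -> : v 0 ^+ 2 = c0 * v 1 ^+ 2 by rewrite /c0 divfK// expf_neq0// gt_eqF.
  apply: (@le_trans _ _ (c0 * (c1 * v n.+1 ^+ 2))).
    by rewrite ler_wpM2l ?H// ltW.
  by rewrite mulrA ler_wpM2r ?sqr_ge0// mulrC ler_wpM2l//; lra.
- apply: le_trans (H _ _ _ kn) _ => //.
  by rewrite ler_wpM2r ?sqr_ge0// ler_peMr//; lra.
Qed.

(** [slopeS] multiplied by v_(k+1) telescopes; this is the reciprocal of the Christoffel function at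
    1 in closed form. *)
Lemma endpoint_sum k :
  a k * (2 * k%:R + 1 + s) * v k * v k.+1 = 2 * beta * \sum_(j < k.+1) v j ^+ 2.
Proof.
elim: k => [|k IH].
  rewrite big_ord_recr big_ord0 /= add0r.
  have -> : 2 * beta * v 0 ^+ 2 = 2 * beta * v 0 * v 0 by ring.
  by rewrite -slope0; ring.
rewrite big_ord_recr /= [RHS]mulrDr -IH.
have -> : 2 * beta * v k.+1 ^+ 2 = 2 * beta * v k.+1 * v k.+1 by ring.
by rewrite -slopeS -(natr1 k); ring.
Qed.

Lemma endpoint_sum_ge k : k.+1%:R * v k ^+ 2 <= 4 * beta * \sum_(j < k.+1) v j ^+ 2.
Proof.
have s0 := jacobi_shift_ge0; have ha := halpha; have hb := hbeta.
case: k => [|k].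
  by rewrite big_ord_recr big_ord0 /= add0r mul1r ler_peMl ?sqr_ge0//; lra.
have k1R : 1 <= k.+1%:R :> R by rewrite ler1n.
have h : 2 * beta * (\sum_(j < k.+2) v j ^+ 2) * (2 * k.+1%:R + s) =
   2 * (k.+1%:R + s) * (k.+1%:R + beta) * v k.+1 ^+ 2.
  by rewrite -endpoint_sum expr2 mulrA -ratio; ring.
have d0 : 0 < 2 * k.+1%:R + s by lra.
rewrite -(ler_pM2r d0) -(natr1 k.+1).
have -> : 4 * beta * (\sum_(j < k.+2) v j ^+ 2) * (2 * k.+1%:R + s) =
   4 * (k.+1%:R + s) * (k.+1%:R + beta) * v k.+1 ^+ 2.
  transitivity (2 * (2 * beta * (\sum_(j < k.+2) v j ^+ 2) * (2 * k.+1%:R + s))).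
    by ring.
  by rewrite h; ring.
rewrite mulrAC ler_wpM2r ?sqr_ge0//; nra.
Qed.

End EndpointAsymptotics.

(** * The oscillatory range *)

Section Energy.
Variables (R : realType) (a b f : nat -> R) (t c0 : R).
Hypotheses (t_gt0 : 0 < t) (t_le1 : t <= 1) (c0_ge0 : 0 <= c0).
Hypothesis rec : forall k,
  (1 - t) * f k.+1 = a k.+1 * f k.+2 + b k.+1 * f k.+1 + a k * f k.
Hypothesis a_asymp : forall k, (1 <= k)%N -> `|1 - 2 * a k| <= c0 / k.+1%:R ^+ 2.
Hypothesis b_asymp : forall k, (1 <= k)%N -> `|2 * b k| <= c0 / k.+1%:R ^+ 2.

(** Defect in the constant-coefficient recurrence, which cosines of step theta, cos theta = 1 - t,
    solve exactly. *)
Let r k := f k.+2 + f k - 2 * (1 - t) * f k.+1.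
Let tau := Num.sqrt t.

(* For [f k = A * cos (k * theta + phase)] and [1 - t = cos theta], this is the
   constant [A ^+ 2 * sin theta ^+ 2]. *)
Definition energy (k : nat) : R := f k.+1 ^+ 2 + f k ^+ 2 - 2 * (1 - t) * f k.+1 * f k.

Local Notation D := energy.

Lemma energy_geL k : t * f k ^+ 2 <= D k.
Proof.
have t0 := t_gt0; have t1 := t_le1.
have -> : D k = (f k.+1 - (1 - t) * f k) ^+ 2 + t * (2 - t) * f k ^+ 2.
  by rewrite /energy; ring.
rewrite -[leLHS]add0r lerD ?sqr_ge0// ler_wpM2r ?sqr_ge0//.
by rewrite ler_peMr//; lra.
Qed.

Lemma energy_geR k : t * f k.+1 ^+ 2 <= D k.
Proof.
have t0 := t_gt0; have t1 := t_le1.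
have -> : D k = (f k - (1 - t) * f k.+1) ^+ 2 + t * (2 - t) * f k.+1 ^+ 2.
  by rewrite /energy; ring.
rewrite -[leLHS]add0r lerD ?sqr_ge0// ler_wpM2r ?sqr_ge0//.
by rewrite ler_peMr//; lra.
Qed.

(** The squared difference carries no small factor t, unlike the squared sum. Pairing one of each
    costs 1/sqrt t only. *)
Lemma energy_split k :
  2 * D k = (2 - t) * (f k.+1 - f k) ^+ 2 + t * (f k.+1 + f k) ^+ 2.
Proof. by rewrite /energy; ring. Qed.

Lemma energy_ge_diff k : (f k.+1 - f k) ^+ 2 <= 2 * D k.
Proof.
have t0 := t_gt0; have t1 := t_le1; rewrite energy_split.
have h1 : 0 <= (1 - t) * (f k.+1 - f k) ^+ 2 by rewrite mulr_ge0 ?sqr_ge0//; lra.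
have h2 : 0 <= t * (f k.+1 + f k) ^+ 2 by rewrite mulr_ge0 ?sqr_ge0//; lra.
by lra.
Qed.

Lemma energy_ge_sum k : t * (f k.+1 + f k) ^+ 2 <= 2 * D k.
Proof.
have t0 := t_gt0; have t1 := t_le1; rewrite energy_split lerDr.
by rewrite mulr_ge0 ?sqr_ge0//; lra.
Qed.

Lemma energy_ge_pair k : t * (f k ^+ 2 + f k.+1 ^+ 2) <= 2 * D k.
Proof. by have := energy_geL k; have := energy_geR k; lra. Qed.

Lemma energy_le_pair k : D k <= 2 * (f k ^+ 2 + f k.+1 ^+ 2).
Proof.
have t0 := t_gt0; have t1 := t_le1; rewrite /energy.
set x := f k.+1; set y := f k.
have : 0 <= (1 - t) * (x + y) ^+ 2 by rewrite mulr_ge0 ?sqr_ge0//; lra.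
have : 0 <= t * (x ^+ 2 + y ^+ 2) by rewrite mulr_ge0 ?addr_ge0 ?sqr_ge0 ?ltW.
by lra.
Qed.

Lemma energy_ge0 k : 0 <= D k.
Proof. by apply: le_trans (energy_geL k); rewrite mulr_ge0 ?sqr_ge0// ltW. Qed.

Lemma defect_le k : (1 <= k)%N ->
  `|r k| <= c0 / k.+1%:R ^+ 2 * (`|f k.+2| + `|f k.+1| + `|f k|).
Proof.
move=> k1.
have -> : r k = (1 - 2 * a k.+1) * f k.+2 - 2 * b k.+1 * f k.+1 + (1 - 2 * a k) * f k.
  rewrite /r; have -> : 2 * (1 - t) * f k.+1 = 2 * ((1 - t) * f k.+1) by ring.
  by rewrite rec; ring.
have dec : c0 / k.+2%:R ^+ 2 <= c0 / k.+1%:R ^+ 2.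
  rewrite ler_wpM2l// lef_pV2 ?posrE ?exprn_gt0// ler_sqr ?nnegrE//.
  by rewrite ler_nat.
apply: le_trans (ler_normD _ _) _; rewrite mulrDr lerD//; last first.
  by rewrite normrM ler_wpM2r ?a_asymp.
apply: le_trans (ler_normB _ _) _; rewrite mulrDr lerD// normrM ler_wpM2r//.
  by apply: le_trans dec; exact: a_asymp.
by apply: le_trans dec; exact: b_asymp.
Qed.

Let sqrt_t_gt0 : 0 < tau. Proof. by rewrite sqrtr_gt0. Qed.

Let sqrt_tK : tau ^+ 2 = t. Proof. by rewrite sqr_sqrtr ?ltW. Qed.

Lemma sqrt_mul_le (x y M N : R) : t * x ^+ 2 <= M -> y ^+ 2 <= N ->
  tau * (`|x| * `|y|) <= (M + N) / 2.
Proof.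
have := sqrt_t_gt0; have := sqrt_tK => <- tau0.
rewrite -(real_normK (num_real x)) -(real_normK (num_real y)) => h1 h2.
have : 0 <= (tau * `|x| - `|y|) ^+ 2 by exact: sqr_ge0.
by rewrite sqrrB !exprMn; lra.
Qed.

(** The exact increment is [r k * (f k.+2 - f k)]. The second factor is a sum of two consecutive
    differences, bounded by the energies without t; the values in the defect cost 1/sqrt t. *)
Lemma energy_drift k : (1 <= k)%N ->
  `|D k.+1 - D k| <= 8 * c0 / tau / k.+1%:R ^+ 2 * (D k + D k.+1).
Proof.
move=> k1; have tau0 := sqrt_t_gt0.
have -> : D k.+1 - D k = r k * (f k.+2 - f k) by rewrite /energy /r; ring.
have d0 := energy_ge0 k; have d1 := energy_ge0 k.+1.
have g : (f k.+2 - f k) ^+ 2 <= 4 * (D k + D k.+1).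
  have h1 := energy_ge_diff k; have h2 := energy_ge_diff k.+1.
  have : 0 <= ((f k.+2 - f k.+1) - (f k.+1 - f k)) ^+ 2 by exact: sqr_ge0.
  by lra.
have f0 : t * f k ^+ 2 <= D k + D k.+1 by have := energy_geL k; lra.
have f1 : t * f k.+1 ^+ 2 <= D k + D k.+1 by have := energy_geR k; lra.
have f2 : t * f k.+2 ^+ 2 <= D k + D k.+1 by have := energy_geR k.+1; lra.
have h : tau * ((`|f k.+2| + `|f k.+1| + `|f k|) * `|f k.+2 - f k|) <= 8 * (D k + D k.+1).
  have := sqrt_mul_le _ _ _ _ f0 g; have := sqrt_mul_le _ _ _ _ f1 g.
  by have := sqrt_mul_le _ _ _ _ f2 g; lra.
rewrite normrM.
apply: (@le_trans _ _ (c0 / k.+1%:R ^+ 2 * (`|f k.+2| + `|f k.+1| + `|f k|) * `|f k.+2 - f k|)).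
  by rewrite ler_wpM2r// defect_le.
have -> : 8 * c0 / tau / k.+1%:R ^+ 2 * (D k + D k.+1) =
  c0 / k.+1%:R ^+ 2 * (8 * (D k + D k.+1) / tau) by ring.
rewrite -[leLHS]mulrA ler_wpM2l ?divr_ge0 ?sqr_ge0//.
by rewrite ler_pdivlMr// mulrC.
Qed.

Variables (c : R) (K : nat).
Hypotheses (c_gt0 : 0 < c) (K_ge1 : (1 <= K)%N) (K_tau : c <= K%:R * tau)
  (K_large : 16 * c0 / c <= K.+1%:R).
Let E := expR (64 * c0 / c).

(** From [K] on, the drift constant is at most a multiple of [K], so the accumulated factor is at
    most [E], which does not depend on t. *)
Let e_le : 8 * c0 / tau <= 8 * c0 / c * K%:R.
Proof.
have tau0 := sqrt_t_gt0; have cc := c_gt0.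
rewrite ler_pdivrMr//.
have -> : 8 * c0 / c * K%:R * tau = 8 * c0 * (K%:R * tau / c) by ring.
by rewrite ler_peMr ?mulr_ge0// ler_pdivlMr// mul1r.
Qed.

(** [K_large] gives d <= 1/2, whence (1 + d) / (1 - d) <= 1 + 4 d. *)
Lemma energy_step k : (K <= k)%N ->
  D k.+1 <= D k * (1 + 32 * c0 / tau / k.+1%:R ^+ 2) /\
  D k <= D k.+1 * (1 + 32 * c0 / tau / k.+1%:R ^+ 2).
Proof.
move=> Kk; have k1 := leq_trans K_ge1 Kk.
have d0 := energy_ge0 k; have d1 := energy_ge0 k.+1.
set d := 8 * c0 / tau / k.+1%:R ^+ 2.
have -> : 32 * c0 / tau / k.+1%:R ^+ 2 = 4 * d by rewrite /d; ring.
have dge0 : 0 <= d.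
  by rewrite /d divr_ge0 ?sqr_ge0// divr_ge0 ?mulr_ge0// ltW// sqrt_t_gt0.
have dle : d <= 1 / 2.
  rewrite /d ler_pdivrMr ?exprn_gt0//; apply: le_trans e_le _.
  apply: (@le_trans _ _ (K.+1%:R / 2 * K.+1%:R)).
    apply: ler_pM => //; first by rewrite divr_ge0 ?mulr_ge0// ltW.
      by rewrite ler_pdivlMr// mulrAC -[8 * _ * _]mulrAC; move: K_large; lra.
    by rewrite ler_nat.
  have : K.+1%:R <= k.+1%:R :> R by rewrite ler_nat ltnS.
  by have : 0 <= K.+1%:R :> R by []; nra.
have := energy_drift k k1; rewrite -/d ler_norml => /andP[h1 h2].
by split; nra.
Qed.

Let exp_le : expR (2 * (32 * c0 / tau) / K.+1%:R) <= E.
Proof.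
have tau0 := sqrt_t_gt0.
rewrite ler_expR ler_pdivrMr//.
have -> : 2 * (32 * c0 / tau) = 8 * (8 * c0 / tau) by ring.
apply: (@le_trans _ _ (8 * (8 * c0 / c * K%:R))); first by rewrite ler_pM2l.
have -> : 8 * (8 * c0 / c * K%:R) = 64 * c0 / c * K%:R by ring.
by rewrite ler_wpM2l ?ler_nat// divr_ge0 ?mulr_ge0// ltW.
Qed.

Lemma energy_le n : (K <= n)%N -> D n <= E * D K.
Proof.
move=> Kn; have tau0 := sqrt_t_gt0.
have e0 : 0 <= 32 * c0 / tau by rewrite divr_ge0 ?mulr_ge0// ltW.
have := expR_drift D _ K n e0 energy_ge0 (fun k Kk => (energy_step k Kk).1) Kn.
move=> /le_trans; apply; rewrite mulrC ler_wpM2r ?energy_ge0//.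
Qed.

Lemma energy_ge n : (K <= n)%N -> D K <= E * D n.
Proof.
move=> Kn; have tau0 := sqrt_t_gt0.
have e0 : 0 <= 32 * c0 / tau by rewrite divr_ge0 ?mulr_ge0// ltW.
have := le_expR_drift D _ K n e0 energy_ge0 (fun k Kk => (energy_step k Kk).2) Kn.
move=> /le_trans; apply; rewrite mulrC ler_wpM2r ?energy_ge0//.
Qed.

Let G := E * D K / t.

Let E_gt0 : 0 < E. Proof. exact: expR_gt0. Qed.

Lemma sqr_le_energy n : (K <= n)%N -> f n ^+ 2 <= G.
Proof.
move=> Kn; rewrite /G ler_pdivlMr// mulrC.
exact: le_trans (energy_geL n) (energy_le n Kn).
Qed.

Let T n := (f n.+1 ^+ 2 - f n ^+ 2) / 2.

(** [T n] is half the product of a sum and a difference, so it is O(D / sqrt t); after division by t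
    this is of the order of K terms of the sum. *)
Lemma energy_boundary n : (K <= n)%N -> `|T n| <= E * D K / tau.
Proof.
move=> Kn; have tau0 := sqrt_t_gt0; rewrite ler_pdivlMr//.
apply: le_trans (energy_le n Kn).
have -> : T n = (f n.+1 + f n) * (f n.+1 - f n) / 2 by rewrite /T; ring.
rewrite !normrM (gtr0_norm (_ : 0 < 2^-1 :> R)) ?invr_gt0//.
have := sqrt_mul_le _ _ _ _ (energy_ge_sum n) (energy_ge_diff n).
by lra.
Qed.

(** Discrete form of 2 sin^2 theta A^2 cos^2 x = D (1 + cos 2x): the oscillating part is the
    increment of [T], up to the defect. *)
Lemma energy_sum_step n : (K <= n)%N ->
  D K / E - 6 * c0 * G / n.+1%:R ^+ 2 <= 4 * t * f n.+1 ^+ 2 + (T n.+1 - T n).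
Proof.
move=> Kn; have n1 := leq_trans K_ge1 Kn; have t0 := t_gt0; have t1 := t_le1.
have id1 : 2 * (t * (2 - t)) * f n.+1 ^+ 2 + (T n.+1 - T n) =
    D n + r n * ((f n.+2 - f n) / 2 + (1 - t) * f n.+1).
  by rewrite /T /energy /r; field.
have le1 : 2 * (t * (2 - t)) * f n.+1 ^+ 2 <= 4 * t * f n.+1 ^+ 2.
  by rewrite ler_wpM2r ?sqr_ge0//; nra.
have le2 : D K / E <= D n by rewrite ler_pdivrMr// mulrC energy_ge.
have G0 : 0 <= G by apply: le_trans (sqr_ge0 _) (sqr_le_energy K _).
have F0 := sqrtr_ge0 G; set F := Num.sqrt G in F0.
have FF : F * F = G by rewrite -expr2 sqr_sqrtr.
have fF j : (K <= j)%N -> `|f j| <= F.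
  by move=> Kj; rewrite -sqrtr_sqr ler_wsqrtr// sqr_le_energy.
have f0 := fF _ Kn; have f1 := fF _ (leqW Kn); have f2 := fF _ (leqW (leqW Kn)).
have q : `|(f n.+2 - f n) / 2 + (1 - t) * f n.+1| <= 2 * F.
  apply: le_trans (ler_normD _ _) _.
  rewrite !normrM (gtr0_norm (_ : 0 < 2^-1 :> R)) ?invr_gt0// (ger0_norm (_ : 0 <= 1 - t)); last by lra.
  have u : `|f n.+2 - f n| <= `|f n.+2| + `|f n| by exact: ler_normB.
  have w : (1 - t) * `|f n.+1| <= 1 * F by apply: ler_pM => //; lra.
  by lra.
have le3 : `|r n * ((f n.+2 - f n) / 2 + (1 - t) * f n.+1)| <= 6 * c0 * G / n.+1%:R ^+ 2.
  rewrite normrM -FF.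
  have -> : 6 * c0 * (F * F) / n.+1%:R ^+ 2 = c0 / n.+1%:R ^+ 2 * (3 * F) * (2 * F) by ring.
  apply: ler_pM => //; apply: le_trans (defect_le n n1) _.
  by rewrite ler_wpM2l ?divr_ge0 ?sqr_ge0//; lra.
have := ler_norml (r n * ((f n.+2 - f n) / 2 + (1 - t) * f n.+1)) (6 * c0 * G / n.+1%:R ^+ 2).
rewrite le3 => /esym/andP[h1 _].
rewrite lerBlDr; apply: le_trans le2 _.
have aux (d p i u w x : R) : i + x = d + p -> i <= u -> - w <= p -> d <= u + x + w.
  by lra.
exact: aux id1 le1 h1.
Qed.

Lemma energy_sum m :
  m%:R * (D K / E) - 6 * c0 * G * (K%:R^-1 - (K + m)%:R^-1)
  <= 4 * t * (\sum_(j < (K + m).+1) f j ^+ 2 - \sum_(j < K.+1) f j ^+ 2) + (T (K + m)%N - T K).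
Proof.
elim: m => [|m IH]; first by rewrite addn0 !subrr mulr0 addr0 mul0r mulr0 subr0.
have step := energy_sum_step _ (leq_addr m K).
have G0 : 0 <= G by apply: le_trans (sqr_ge0 _) (sqr_le_energy K _).
rewrite addnS [\sum_(j < (K + m).+2) _]big_ord_recr /= -(natr1 m).
have Km : 0 < (K + m)%:R :> R by rewrite ltr0n addn_gt0 K_ge1.
have inv : ((K + m).+1%:R ^+ 2)^-1 <= (K + m)%:R^-1 - (K + m).+1%:R^-1 :> R.
  rewrite -(natr1 (K + m)); set x : R := (K + m)%:R in Km *.
  have -> : x^-1 - (x + 1)^-1 = ((x + 1) ^+ 2)^-1 + (x * (x + 1) ^+ 2)^-1.
    by field; apply/andP; split; rewrite gt_eqF//; lra.
  by rewrite lerDl invr_ge0 mulr_ge0 ?sqr_ge0// ltW.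
have Y0 : 0 <= 6 * c0 * G by apply: mulr_ge0 => //; exact: mulr_ge0.
have inv' := ler_wpM2l Y0 inv.
have aux (x y z u w w' s0 s1 p q q' q'' : R) :
    m%:R * x - y * (u - w) <= 4 * t * (s1 - s0) + (q' - q) ->
    x - y * z <= 4 * t * p + (q'' - q') -> y * z <= y * (w - w') ->
    (m%:R + 1) * x - y * (u - w') <= 4 * t * (s1 + p - s0) + (q'' - q).
  by lra.
exact: aux IH step inv'.
Qed.

End Energy.

(** [A] is the size of f^2 at the transition index [K]. Beyond [K], values stay O(A) and the sum
    gains at least c2 (n - K) A minus C4 K A; this deficit is absorbed by the sum up to [K], itself
    at least c3 (K + 1) A. The constant is chosen before all sequences and t. *)
Lemma christoffel_ratio_oscillatory {R : realType} (c0 c c1 C1 c3 C3 : R) :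
  0 <= c0 -> 0 < c -> 0 < c1 -> 0 <= C1 -> 0 < c3 -> 0 <= C3 ->
  exists2 C : R, 0 <= C & forall (a b f : nat -> R) (t A : R) (K : nat),
    0 < t -> t <= 1 ->
    (forall k, (1 - t) * f k.+1 = a k.+1 * f k.+2 + b k.+1 * f k.+1 + a k * f k) ->
    (forall k, (1 <= k)%N -> `|1 - 2 * a k| <= c0 / k.+1%:R ^+ 2) ->
    (forall k, (1 <= k)%N -> `|2 * b k| <= c0 / k.+1%:R ^+ 2) ->
    (1 <= K)%N -> c <= K%:R * Num.sqrt t -> 16 * c0 / c <= K.+1%:R -> 0 <= A ->
    c1 * t * A <= energy R f t K -> energy R f t K <= C1 * t * A ->
    c3 * K.+1%:R * A <= \sum_(j < K.+1) f j ^+ 2 ->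
    (forall k, (k <= K)%N -> f k ^+ 2 <= C3 * A) ->
    forall n k, (K <= n)%N -> (k <= n)%N ->
      n.+1%:R * f k ^+ 2 <= C * \sum_(j < n.+1) f j ^+ 2.
Proof.
move=> c0_ge0 c_gt0 c1_gt0 C1_ge0 c3_gt0 C3_ge0.
have [E [E0 EE]] : exists E, 0 < E /\ expR (64 * c0 / c) = E.
  by exists (expR (64 * c0 / c)); rewrite expR_gt0.
(* The two summands of [C4] account for the boundary terms at [n] and [K] and for the accumulated
   defect. *)
pose c2 := c1 / (4 * E); pose C4 := E * C1 / (2 * c) + 3 * c0 * E * C1 / (2 * c ^+ 2).
have c2_gt0 : 0 < c2 by rewrite divr_gt0// mulr_gt0.
have C4_ge0 : 0 <= C4.
  by rewrite addr_ge0// divr_ge0 ?mulr_ge0 ?sqr_ge0// ltW.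
pose m0 := Num.min c2 c3; have m0_gt0 : 0 < m0 by rewrite lt_min c2_gt0.
exists ((C3 + E * C1) * (1 + C4 / c3) / m0).
  rewrite divr_ge0 ?(ltW m0_gt0)// mulr_ge0// addr_ge0// ?divr_ge0 ?mulr_ge0// ltW//.
move=> a b f t A K t0 t1 rec ha hb K1 Kt KL A0 Dlow Dup Slow fup n k Kn kn.
set S := fun n => \sum_(j < n.+1) f j ^+ 2; rewrite -/(S n).
have tau0 : 0 < Num.sqrt t by rewrite sqrtr_gt0.
have K0 : 0 < K%:R :> R by rewrite ltr0n.
have tauK : Num.sqrt t ^+ 2 = t by rewrite sqr_sqrtr ?ltW.
have D0 := energy_ge0 R f t t0 t1 K; set DK := energy R f t K in Dlow Dup D0 *.
have fk : f k ^+ 2 <= (C3 + E * C1) * A.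
  rewrite mulrDl; have [kK|Kk] := leqP k K.
    by apply: le_trans (fup _ kK) _; rewrite lerDl !mulr_ge0// ltW.
  apply: (@le_trans _ _ (E * C1 * A)); last by rewrite lerDr mulr_ge0.
  have := sqr_le_energy R a b f t c0 t0 t1 c0_ge0 rec ha hb c K c_gt0 K1 Kt KL k (ltnW Kk).
  rewrite EE -/DK => /le_trans; apply; rewrite ler_pdivrMr//.
  by rewrite -!mulrA ler_wpM2l ?(ltW E0)// [A * t]mulrC mulrA.
have sumK : (n - K)%:R * (4 * t * (c2 * A)) - 4 * t * (C4 * K%:R * A) <= 4 * t * (S n - S K).
  have := energy_sum R a b f t c0 t0 t1 c0_ge0 rec ha hb c K c_gt0 K1 Kt KL (n - K)%N.
  have := energy_boundary R a b f t c0 t0 t1 c0_ge0 rec ha hb c K c_gt0 K1 Kt KL K (leqnn K).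
  have := energy_boundary R a b f t c0 t0 t1 c0_ge0 rec ha hb c K c_gt0 K1 Kt KL n Kn.
  rewrite EE -/DK subnKC// -/(S n) -/(S K).
  set Tn := (_ - _) / 2; set TK := (_ - _) / 2.
  rewrite !ler_norml => /andP[_ Tn1] /andP[TK1 _] main.
  have i1 : E * DK / Num.sqrt t <= 2 * t * (E * C1 / (2 * c) * K%:R * A).
    rewrite ler_pdivrMr//.
    have -> : 2 * t * (E * C1 / (2 * c) * K%:R * A) * Num.sqrt t =
      E * (C1 * t * A * (K%:R * Num.sqrt t / c)) by field; rewrite gt_eqF.
    rewrite ler_wpM2l ?(ltW E0)//; apply: (le_trans Dup).
    by rewrite ler_peMr ?mulr_ge0 ?(ltW t0)// ler_pdivlMr// mul1r.
  have cK : c ^+ 2 <= t * K%:R ^+ 2.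
    by rewrite -tauK -exprMn mulrC ler_sqr ?nnegrE ?mulr_ge0 ?(ltW c_gt0)// ltW.
  have G0 : 0 <= 6 * c0 * (E * DK / t) by rewrite !(mulr_ge0, divr_ge0, invr_ge0)// ltW.
  have i2 : 6 * c0 * (E * DK / t) * (K%:R^-1 - n%:R^-1) <=
      4 * t * (3 * c0 * E * C1 / (2 * c ^+ 2) * K%:R * A).
    apply: (@le_trans _ _ (6 * c0 * (E * DK / t) * K%:R^-1)).
      by rewrite ler_wpM2l// gerBl invr_ge0.
    have -> : 6 * c0 * (E * DK / t) * K%:R^-1 = 6 * c0 * E * (DK / (t * K%:R)).
      by field; rewrite !gt_eqF.
    have -> : 4 * t * (3 * c0 * E * C1 / (2 * c ^+ 2) * K%:R * A) =
      6 * c0 * E * (C1 * t * A * K%:R / c ^+ 2) by field; rewrite gt_eqF.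
    rewrite ler_wpM2l ?mulr_ge0 ?(ltW E0)// ler_pdivrMr ?mulr_gt0//.
    have -> : C1 * t * A * K%:R / c ^+ 2 * (t * K%:R) =
      C1 * t * A * (t * K%:R ^+ 2 / c ^+ 2) by ring.
    apply: (le_trans Dup); rewrite ler_peMr ?mulr_ge0 ?(ltW t0)//.
    by rewrite ler_pdivlMr ?exprn_gt0// mul1r.
  have i3 : 4 * t * (c2 * A) <= DK / E.
    rewrite ler_pdivlMr//; apply: le_trans Dlow.
    by rewrite /c2 le_eqVlt; apply/orP; left; apply/eqP; field; rewrite gt_eqF.
  have i4 := ler_wpM2l (ler0n R (n - K)) i3.
  by rewrite /C4; lra.
have {}sumK : (n - K)%:R * c2 * A - C4 * K%:R * A <= S n - S K.
  rewrite -(ler_pM2l (_ : 0 < 4 * t)) ?mulr_gt0//.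
  by apply: le_trans sumK; rewrite le_eqVlt; apply/orP; left; apply/eqP; ring.
have SKn : S K <= S n.
  rewrite /S -(subnKC Kn); elim: (n - K)%N => [|m IH]; first by rewrite addn0.
  by rewrite addnS [leRHS]big_ord_recr /= ler_wpDr ?sqr_ge0.
have nK : n.+1%:R = (n - K)%:R + K.+1%:R :> R by rewrite -natrD addnS subnK.
have fin : m0 * (n.+1%:R * A) <= (1 + C4 / c3) * S n.
  have j1 : C4 * K%:R * A <= C4 / c3 * S n.
    apply: (@le_trans _ _ (C4 / c3 * (c3 * K.+1%:R * A))).
      have -> : C4 / c3 * (c3 * K.+1%:R * A) = C4 * K.+1%:R * A.
        by field; rewrite gt_eqF.
      by rewrite ler_wpM2r// ler_wpM2l// ler_nat.
    by rewrite ler_wpM2l ?divr_ge0 ?(ltW c3_gt0)//; exact: le_trans Slow SKn.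
  have j2 : m0 * ((n - K)%:R * A) <= (n - K)%:R * c2 * A.
    have -> : (n - K)%:R * c2 * A = c2 * ((n - K)%:R * A) by ring.
    by rewrite ler_wpM2r ?mulr_ge0// /m0 ge_min lexx.
  have j3 : m0 * (K.+1%:R * A) <= c3 * K.+1%:R * A.
    by rewrite -mulrA ler_wpM2r ?mulr_ge0// /m0 ge_min lexx orbT.
  by rewrite nK; move: Slow; rewrite -/(S K); lra.
have n0 : 0 <= n.+1%:R :> R by [].
apply: (@le_trans _ _ (n.+1%:R * ((C3 + E * C1) * A))); first by rewrite ler_wpM2l.
have -> : (C3 + E * C1) * (1 + C4 / c3) / m0 * S n =
  (C3 + E * C1) * ((1 + C4 / c3) * S n / m0) by ring.
have -> : n.+1%:R * ((C3 + E * C1) * A) = (C3 + E * C1) * (n.+1%:R * A) by ring.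
rewrite ler_wpM2l ?addr_ge0 ?mulr_ge0 ?(ltW E0)//.
by rewrite ler_pdivlMr// mulrC.
Qed.

(** * Comparison with the Christoffel function *)

Lemma sqr_half_le {R : realFieldType} (x y : R) :
  0 <= y -> y / 2 <= x -> y ^+ 2 / 4 <= x ^+ 2.
Proof.
move=> y0 yx; have : 0 <= (x - y / 2) * (x + y / 2) by rewrite mulr_ge0//; lra.
by lra.
Qed.

Section ChristoffelRatio.
Variables (R : realType) (alpha beta : R) (a b v : nat -> R) (f : R -> nat -> R).
Local Notation s := (alpha + beta - 1).
Hypotheses (halpha : 1 / 2 <= alpha) (hbeta : 1 / 2 <= beta).
Hypothesis v_gt0 : forall k, 0 < v k.
Hypothesis slope0 : a 0 * (1 + s) * v 1 = 2 * beta * v 0.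
Hypothesis slopeS : forall k,
  a k.+1 * (2 * k%:R + 3 + s) * v k.+2 - a k * (2 * k%:R + 1 + s) * v k
  = 2 * beta * v k.+1.
Hypothesis ratio : forall k,
  a k * (2 * k%:R + 1 + s) * (2 * k%:R + s) * v k.+1
  = 2 * (k%:R + s) * (k%:R + beta) * v k.
Hypothesis value0 : v 0 = a 0 * v 1 + b 0 * v 0.
Hypothesis value : forall k,
  v k.+1 = a k.+1 * v k.+2 + b k.+1 * v k.+1 + a k * v k.
Hypothesis f0 : forall t, f t 0 = v 0.
Hypothesis rec0 : forall t, (1 - t) * f t 0 = a 0 * f t 1 + b 0 * f t 0.
Hypothesis rec : forall t k,
  (1 - t) * f t k.+1 = a k.+1 * f t k.+2 + b k.+1 * f t k.+1 + a k * f t k.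
Variable M : nat -> R.
Hypothesis f_bounded : forall t k, 0 <= t -> t <= 1 -> f t k ^+ 2 <= M k.

Local Notation lam k := (k%:R * (k%:R + s)).

Let s_ge0 : 0 <= s. Proof. exact: jacobi_shift_ge0. Qed.
Let beta_gt0 : 0 < beta. Proof. by have hb := hbeta; lra. Qed.
Let a_gt0 k : 0 < a k.
Proof. exact: (offdiag_gt0 R alpha beta a v halpha hbeta v_gt0 slopeS ratio). Qed.

(** Christoffel-Darboux identity between the points 1 and 1 - t: cross-multiplying the two
    recurrences cancels [b]. *)
Lemma wronskian t k : a k * (v k * f t k.+1 - v k.+1 * f t k) =
  - t * \sum_(j < k.+1) v j * f t j.
Proof.
elim: k => [|k IH].
  rewrite big_ord_recr big_ord0 /= add0r mulrBr.
  have -> : a 0 * (v 0 * f t 1) = v 0 * ((1 - t) * f t 0 - b 0 * f t 0).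
    by rewrite rec0; ring.
  have -> : a 0 * (v 1 * f t 0) = (v 0 - b 0 * v 0) * f t 0.
    have -> : v 0 - b 0 * v 0 = a 0 * v 1 by rewrite [X in X - _]value0; ring.
    by ring.
  by ring.
rewrite big_ord_recr /= [RHS]mulrDr -IH mulrBr.
have -> : a k.+1 * (v k.+1 * f t k.+2) =
    v k.+1 * ((1 - t) * f t k.+1 - b k.+1 * f t k.+1 - a k * f t k).
  by rewrite rec; ring.
have -> : a k.+1 * (v k.+2 * f t k.+1) =
    (v k.+1 - b k.+1 * v k.+1 - a k * v k) * f t k.+1.
  have -> : v k.+1 - b k.+1 * v k.+1 - a k * v k = a k.+1 * v k.+2.
    by rewrite [X in X - _ - _]value; ring.
  by ring.
by ring.
Qed.

Lemma lam_homo j k : (j <= k)%N -> lam j <= lam k.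
Proof.
move=> jk; have s0 := s_ge0; have jkR : j%:R <= k%:R :> R by rewrite ler_nat.
have j0 : 0 <= j%:R :> R by [].
by apply: ler_pM => //; lra.
Qed.

(** The lower bound is the tangent line at z = 1. By induction the sum in [wronskian] lies between 0
    and the sum of v_j^2, known from [endpoint_sum]; so f_k / v_k decreases, by at most t (2k + 1 +
    s) / (2 beta) per step, and 2k + 1 + s is the increment of [lam]. *)
Lemma near_endpoint t k : 0 <= t -> t * lam k <= beta ->
  v k * (1 - t * lam k / (2 * beta)) <= f t k <= v k.
Proof.
move=> t0; have s0 := s_ge0; have b0 := beta_gt0; have b20 : 0 < 2 * beta by lra.
elim/ltn_ind: k => k; case: k => [_ _|k IH tk].
  by rewrite f0 mul0r mulr0 mul0r subr0 mulr1 lexx.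
have H j : (j <= k)%N -> v j * (1 - t * lam j / (2 * beta)) <= f t j <= v j /\ 0 <= f t j.
  move=> jk; have tj : t * lam j <= beta.
    by apply: le_trans tk; rewrite ler_wpM2l// lam_homo// ltnW.
  have h := IH j jk tj; split => //; have /andP[h1 _] := h.
  apply: le_trans h1; rewrite mulr_ge0 ?(ltW (v_gt0 _))// subr_ge0 ler_pdivrMr//; lra.
have [/andP[l1 l2] l3] := H k (leqnn k).
have W := wronskian t k.
have v0 := v_gt0 k; have v1 := v_gt0 k.+1; have ak := a_gt0 k.
have Sg : 0 <= \sum_(j < k.+1) v j * f t j.
  apply: sumr_ge0 => j _; rewrite mulr_ge0 ?(ltW (v_gt0 _))//.
  by have [_ ->] := H j (ltn_ord j).
have Sl : \sum_(j < k.+1) v j * f t j <= \sum_(j < k.+1) v j ^+ 2.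
  apply: ler_sum => j _; rewrite expr2 ler_wpM2l ?(ltW (v_gt0 _))//.
  by have [/andP[]] := H j (ltn_ord j).
have P := endpoint_sum R alpha beta a v slope0 slopeS k.
have up : v k * f t k.+1 <= v k.+1 * f t k.
  rewrite -subr_le0 -(pmulr_rle0 _ ak) W mulNr oppr_le0 mulr_ge0//.
have lo : v k.+1 * f t k - t * (2 * k%:R + 1 + s) / (2 * beta) * (v k * v k.+1)
    <= v k * f t k.+1.
  rewrite lerBlDr -lerBlDl -(ler_pM2l ak).
  have -> : a k * (v k.+1 * f t k - v k * f t k.+1) = t * \sum_(j < k.+1) v j * f t j.
    transitivity (- (- t * \sum_(j < k.+1) v j * f t j)); last by ring.
    by rewrite -W; ring.
  have -> : a k * (t * (2 * k%:R + 1 + s) / (2 * beta) * (v k * v k.+1)) =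
     t * (a k * (2 * k%:R + 1 + s) * v k * v k.+1 / (2 * beta)) by ring.
  by rewrite P ler_wpM2l// mulrC mulKf// gt_eqF.
apply/andP; split.
  rewrite -(ler_pM2l v0); apply: le_trans lo.
  have := ler_wpM2l (ltW v1) l1; rewrite -(natr1 k).
  have -> : (k%:R + 1) * (k%:R + 1 + s) = lam k + (2 * k%:R + 1 + s) by ring.
  set x := lam k; set e := 2 * k%:R + 1 + s.
  have -> : v k * (v k.+1 * (1 - t * (x + e) / (2 * beta))) =
    v k.+1 * (v k * (1 - t * x / (2 * beta))) - t * e / (2 * beta) * (v k * v k.+1).
    by field; rewrite gt_eqF.
  by rewrite lerD2r.
by rewrite -(ler_pM2l v0); apply: (le_trans up); rewrite mulrC ler_wpM2r// ltW.
Qed.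

Lemma near_endpoint_ge t k : 0 <= t -> t * lam k <= beta -> v k / 2 <= f t k.
Proof.
move=> t0 tk; have /andP[h _] := near_endpoint t k t0 tk; apply: le_trans h.
have b0 := beta_gt0; rewrite ler_pM2l// lerBrDr -lerBrDl ler_pdivrMr; lra.
Qed.

Lemma near_endpoint_increment t k : 0 <= t -> t * lam k.+1 <= beta ->
  `|v k * f t k.+1 - v k.+1 * f t k| <=
  t * (2 * k%:R + 1 + s) / (2 * beta) * (v k * v k.+1).
Proof.
move=> t0 tk; have b0 := beta_gt0; have ak := a_gt0 k.
have H j : (j <= k)%N -> 0 <= f t j <= v j.
  move=> jk; have tj : t * lam j <= beta.
    by apply: le_trans tk; rewrite ler_wpM2l// lam_homo// ltnW.
  have /andP[_ ->] := near_endpoint t j t0 tj; rewrite andbT.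
  by apply: le_trans (near_endpoint_ge t j t0 tj); rewrite divr_ge0// ltW.
rewrite -(ler_pM2l ak) -{1}(gtr0_norm ak) -normrM wronskian mulNr normrN normrM.
rewrite (ger0_norm t0).
have -> : a k * (t * (2 * k%:R + 1 + s) / (2 * beta) * (v k * v k.+1)) =
     t * (a k * (2 * k%:R + 1 + s) * v k * v k.+1 / (2 * beta)) by ring.
have b20 : 2 * beta != 0 by rewrite gt_eqF//; lra.
rewrite (endpoint_sum R alpha beta a v slope0 slopeS k) ler_wpM2l// mulrC mulKf//.
rewrite ger0_norm.
  apply: ler_sum => j _; rewrite expr2 ler_wpM2l ?(ltW (v_gt0 _))//.
  by have /andP[] := H j (ltn_ord j).
apply: sumr_ge0 => j _; rewrite mulr_ge0 ?(ltW (v_gt0 _))//.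
by have /andP[] := H j (ltn_ord j).
Qed.

Lemma near_endpoint_sum t n : 0 <= t -> t * lam n <= beta ->
  n.+1%:R * v n ^+ 2 <= 16 * beta * \sum_(j < n.+1) f t j ^+ 2.
Proof.
move=> t0 tn; have b0 := beta_gt0.
apply: le_trans (endpoint_sum_ge R alpha beta a v halpha hbeta slope0 slopeS ratio n) _.
have -> : 16 * beta = 4 * beta * 4 by ring.
rewrite -[leRHS]mulrA ler_wpM2l ?mulr_ge0 ?(ltW b0)// mulr_sumr; apply: ler_sum => j _.
have tj : t * lam j <= beta.
  by apply: le_trans tn; rewrite ler_wpM2l// lam_homo// -ltnS ltn_ord.
rewrite mulrC -ler_pdivrMr//.
exact: sqr_half_le (ltW (v_gt0 j)) (near_endpoint_ge t j t0 tj).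
Qed.

(* Since [a k <> 0], the recurrence can be solved backwards down to [f t 0 = v 0]. *)
Lemma consecutive_lower k : exists2 d : R, 0 < d &
  forall t, 0 <= t -> t <= 1 -> d <= f t k ^+ 2 + f t k.+1 ^+ 2.
Proof.
elim: k => [|k [d d0 IH]].
  exists (v 0 ^+ 2) => [|t _ _]; first by rewrite exprn_gt0.
  by rewrite f0 lerDl sqr_ge0.
have ak := a_gt0 k.
pose C := 1 + 2 * ((1 + `|b k.+1|) ^+ 2 + a k.+1 ^+ 2) / a k ^+ 2.
have C0 : 0 < C.
  by rewrite ltr_pwDl// divr_ge0 ?sqr_ge0// mulr_ge0// addr_ge0 ?sqr_ge0.
exists (d / C) => [|t t0 t1]; first by rewrite divr_gt0.
rewrite ler_pdivrMr//; apply: le_trans (IH t t0 t1) _.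
have e : f t k * a k = (1 - t - b k.+1) * f t k.+1 - a k.+1 * f t k.+2.
  have h : a k * f t k = (1 - t) * f t k.+1 - a k.+1 * f t k.+2 - b k.+1 * f t k.+1.
    by rewrite rec; ring.
  by rewrite mulrC h; ring.
have q : (1 - t - b k.+1) ^+ 2 <= (1 + `|b k.+1|) ^+ 2.
  rewrite -[leLHS]real_normK ?num_real// ler_sqr ?nnegrE ?addr_ge0//.
  apply: le_trans (ler_normB _ _) _; rewrite lerD2r ger0_norm; lra.
have h : f t k ^+ 2 <= 2 * ((1 + `|b k.+1|) ^+ 2 + a k.+1 ^+ 2) / a k ^+ 2
    * (f t k.+1 ^+ 2 + f t k.+2 ^+ 2).
  rewrite mulrAC ler_pdivlMr ?exprn_gt0// -exprMn e.
  set x := f t k.+1; set y := f t k.+2; set u := 1 - t - b k.+1 in q *.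
  set w := (1 + _) ^+ 2 in q *; set z := a k.+1.
  have i1 : (u * x - z * y) ^+ 2 <= 2 * (u ^+ 2 * x ^+ 2) + 2 * (z ^+ 2 * y ^+ 2).
    have : 0 <= (u * x + z * y) ^+ 2 by exact: sqr_ge0.
    by lra.
  have i2 : u ^+ 2 * x ^+ 2 <= w * x ^+ 2 by rewrite ler_wpM2r ?sqr_ge0.
  have w0 : 0 <= w by rewrite sqr_ge0.
  have i3 : 0 <= w * y ^+ 2 by rewrite mulr_ge0 ?sqr_ge0.
  have i4 : 0 <= z ^+ 2 * x ^+ 2 by rewrite mulr_ge0 ?sqr_ge0.
  by lra.
rewrite /C mulrC mulrDl mul1r addrC lerD//.
by rewrite lerDl sqr_ge0.
Qed.

(** The energy is (x - y)^2 + 2 t x y, so x - y = O(sqrt t v_K) is required. The Wronskian part is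
    O(t K) relative to v_K, and t K^2 <= beta; the increment of v is O(1/K), and K sqrt t >= c. *)
Lemma energy_transition (c : R) : 0 < c ->
  exists2 C1 : R, 0 <= C1 & forall t K, 0 < t -> t <= 1 -> (1 <= K)%N ->
    c <= K%:R * Num.sqrt t -> t * lam K.+1 <= beta ->
    energy R (f t) t K <= C1 * t * v K ^+ 2.
Proof.
move=> c0; have s0 := s_ge0; have b0 := beta_gt0.
have [cv cv0 hcv] := endpoint_increment R alpha beta a v halpha hbeta v_gt0 slopeS ratio.
pose B := Num.sqrt beta.
pose m := (2 + s) * B / (2 * beta) * (1 + cv) + cv / c.
have m0 : 0 <= m.
  apply: addr_ge0; last by rewrite divr_ge0// ltW.
  apply: mulr_ge0; last by lra.
  by apply: divr_ge0; [apply: mulr_ge0; [lra|exact: sqrtr_ge0]|lra].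
exists (m ^+ 2 + 2 * (1 + cv)) => [|t K t0 t1 K1 Kt tK].
  by rewrite addr_ge0 ?sqr_ge0// mulr_ge0// addr_ge0.
have v0 := v_gt0 K; have v1 := v_gt0 K.+1.
have tau0 : 0 < Num.sqrt t by rewrite sqrtr_gt0.
have tauK : Num.sqrt t ^+ 2 = t by rewrite sqr_sqrtr ?ltW.
set tau := Num.sqrt t in Kt tau0 tauK *.
have K0 : 0 <= K%:R :> R by [].
have tK0 : t * lam K <= beta.
  by apply: le_trans tK; rewrite ler_wpM2l ?(ltW t0)// lam_homo.
have k1 : K.+1%:R = K%:R + 1 :> R by rewrite natr1.
have K10 : 0 < K.+1%:R :> R by [].
have iK : K.+1%:R^-1 <= tau / c.
  rewrite -[leLHS]mul1r ler_pdivrMr// mulrAC ler_pdivlMr// mul1r k1.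
  by apply: (le_trans Kt); rewrite mulrDr mulr1 mulrC lerDl ltW.
have inc0 := hcv K K1.
have inc : `|v K.+1 - v K| <= cv * v K * (tau / c).
  by apply: (le_trans inc0); rewrite ler_wpM2l ?mulr_ge0 ?(ltW v0).
have vup : v K.+1 <= (1 + cv) * v K.
  have : `|v K.+1 - v K| <= cv * v K.
    apply: (le_trans inc0); rewrite ler_pdivrMr// ler_peMr ?mulr_ge0 ?(ltW v0)//.
    by rewrite ler1n.
  by rewrite ler_norml => /andP[_]; lra.
have tB : tau * K.+1%:R <= B.
  rewrite -ler_sqr ?nnegrE ?sqrtr_ge0 ?mulr_ge0 ?(ltW tau0)// sqr_sqrtr ?(ltW b0)//.
  rewrite exprMn tauK; apply: le_trans tK; rewrite ler_wpM2l ?(ltW t0)// expr2.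
  by rewrite ler_wpM2l// lerDl.
have te : t * (2 * K%:R + 1 + s) <= tau * ((2 + s) * B).
  rewrite -tauK expr2 -mulrA ler_wpM2l ?(ltW tau0)//.
  apply: (@le_trans _ _ ((2 + s) * (tau * K.+1%:R))); last by rewrite ler_wpM2l//; lra.
  have -> : (2 + s) * (tau * K.+1%:R) = tau * ((2 + s) * K.+1%:R) by ring.
  rewrite ler_wpM2l ?(ltW tau0)// k1.
  by have : 0 <= s * K%:R by [apply: mulr_ge0]; lra.
have /andP[x0 x1] : 0 <= f t K.+1 <= v K.+1.
  have /andP[_ ->] := near_endpoint t K.+1 (ltW t0) tK; rewrite andbT.
  by apply: le_trans (near_endpoint_ge t K.+1 (ltW t0) tK); rewrite divr_ge0// ltW.
have /andP[y0 y1] : 0 <= f t K <= v K.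
  have /andP[_ ->] := near_endpoint t K (ltW t0) tK0; rewrite andbT.
  by apply: le_trans (near_endpoint_ge t K (ltW t0) tK0); rewrite divr_ge0// ltW.
have w := near_endpoint_increment t K (ltW t0) tK.
move: x0 x1 y0 y1 w; rewrite /energy; set x := f t K.+1; set y := f t K => x0 x1 y0 y1 w.
have w1 : `|v K * x - v K.+1 * y| <= tau * ((2 + s) * B / (2 * beta) * (1 + cv)) * v K ^+ 2.
  apply: (le_trans w).
  have -> : tau * ((2 + s) * B / (2 * beta) * (1 + cv)) * v K ^+ 2 =
    tau * ((2 + s) * B) / (2 * beta) * (v K * ((1 + cv) * v K)) by ring.
  apply: ler_pM.
  - by rewrite divr_ge0 ?mulr_ge0 ?(ltW t0) ?(ltW b0)//; lra.
  - by rewrite mulr_ge0// ltW.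
  - by rewrite ler_pM2r// invr_gt0 mulr_gt0.
  - by rewrite ler_wpM2l// ltW.
have dxy : `|x - y| <= tau * m * v K.
  rewrite -(ler_pM2l v0) -{1}(gtr0_norm v0) -normrM.
  have -> : v K * (x - y) = (v K * x - v K.+1 * y) + (v K.+1 - v K) * y by ring.
  apply: le_trans (ler_normD _ _) _.
  have w2 : `|(v K.+1 - v K) * y| <= tau * (cv / c) * v K ^+ 2.
    rewrite normrM (ger0_norm y0).
    have -> : tau * (cv / c) * v K ^+ 2 = cv * v K * (tau / c) * v K by ring.
    exact: ler_pM.
  apply: le_trans (lerD w1 w2) _.
  by rewrite /m le_eqVlt; apply/orP; left; apply/eqP; ring.
have dxy2 : (x - y) ^+ 2 <= m ^+ 2 * t * v K ^+ 2.
  rewrite -tauK -real_normK ?num_real//.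
  have -> : m ^+ 2 * tau ^+ 2 * v K ^+ 2 = (tau * m * v K) ^+ 2 by ring.
  by rewrite ler_sqr ?nnegrE ?mulr_ge0// ltW.
have xy : t * (x * y) <= t * ((1 + cv) * v K ^+ 2).
  rewrite ler_wpM2l ?(ltW t0)// expr2 mulrA; apply: ler_pM => //.
  exact: le_trans x1 vup.
have -> : x ^+ 2 + y ^+ 2 - 2 * (1 - t) * x * y = (x - y) ^+ 2 + 2 * (t * (x * y)) by ring.
have -> : (m ^+ 2 + 2 * (1 + cv)) * t * v K ^+ 2 =
  m ^+ 2 * t * v K ^+ 2 + 2 * (t * ((1 + cv) * v K ^+ 2)) by ring.
by rewrite lerD// ler_pM2l.
Qed.

(** Everything hinges on the first index at which t [lam] exceeds [beta]: beyond n, small, or large.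
    The small case forces t away from 0. *)
Theorem christoffel_ratio_le : exists2 C : R, 0 <= C &
  forall t, 0 <= t -> t <= 1 -> forall n k, (k <= n)%N ->
    n.+1%:R * f t k ^+ 2 <= C * \sum_(j < n.+1) f t j ^+ 2.
Proof.
have s0 := s_ge0; have b0 := beta_gt0.
have [ca ca0 aas] := offdiag_asymp R alpha beta a v halpha hbeta v_gt0 slopeS ratio.
have [cb cb0 bas] := diag_asymp R alpha beta a b v halpha hbeta v_gt0 slopeS ratio value.
have [Cv Cv0 vmono] := endpoint_almost_increasing R alpha beta a v halpha hbeta v_gt0 slopeS ratio.
pose c0 := ca + cb; have c0_ge0 : 0 <= c0 by rewrite addr_ge0.
have aas' k : (1 <= k)%N -> `|1 - 2 * a k| <= c0 / k.+1%:R ^+ 2.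
  move=> k1; apply: le_trans (aas k k1) _.
  by rewrite ler_wpM2r ?invr_ge0 ?sqr_ge0// lerDl.
have bas' k : (1 <= k)%N -> `|2 * b k| <= c0 / k.+1%:R ^+ 2.
  move=> k1; apply: le_trans (bas k k1) _.
  by rewrite ler_wpM2r ?invr_ge0 ?sqr_ge0// lerDr.
(* For K >= 1, lam (K + 2) <= 3 (3 + s) K^2, so t lam (K + 2) > beta yields K sqrt t >= c. *)
pose c := Num.sqrt (beta / (3 * (3 + s))).
have c_gt0 : 0 < c by rewrite sqrtr_gt0 divr_gt0// mulr_gt0//; lra.
have cK t K : 0 < t -> (1 <= K)%N -> beta < t * lam K.+2 -> c <= K%:R * Num.sqrt t.
  move=> t0 K1 tK; have K1R : 1 <= K%:R :> R by rewrite ler1n.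
  have d0 : 0 < 3 * (3 + s) by lra.
  rewrite -ler_sqr ?nnegrE ?sqrtr_ge0 ?mulr_ge0 ?sqrtr_ge0//.
  rewrite exprMn !sqr_sqrtr ?(ltW t0) ?divr_ge0 ?(ltW b0) ?(ltW d0)//.
  rewrite ler_pdivrMr//; apply: (le_trans (ltW tK)).
  have -> : K%:R ^+ 2 * t * (3 * (3 + s)) = t * ((3 * K%:R) * ((3 + s) * K%:R)) by ring.
  rewrite ler_wpM2l ?(ltW t0)// -(natr1 K.+1) -(natr1 K).
  have sK : s <= s * K%:R by rewrite ler_peMr.
  by apply: ler_pM; lra.
pose K0 := (Num.bound (16 * c0 / c)).+1.
have K0_large : 16 * c0 / c <= K0.+1%:R.
  have : 0 <= 16 * c0 / c by rewrite divr_ge0 ?mulr_ge0// ltW.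
  move=> /archi_boundP /ltW /le_trans; apply.
  by rewrite ler_nat /K0; do 2 apply: leqW.
have [C1 C10 trans] := energy_transition c c_gt0.
pose Ms := \sum_(j < K0.+2) M j.
have M0 k : 0 <= M k.
  exact: le_trans (sqr_ge0 (f 0 k)) (f_bounded 0 k (lexx _) ler01).
have fM t k : 0 <= t -> t <= 1 -> (k <= K0.+1)%N -> f t k ^+ 2 <= Ms.
  move=> t0 t1 kK; apply: le_trans (f_bounded t k t0 t1) _.
  rewrite /Ms (bigD1 (Ordinal (kK : (k < K0.+2)%N)))//= lerDl.
  by apply: sumr_ge0.
have Ms0 : 0 <= Ms by exact: sumr_ge0.
have [d d0 dlow] := consecutive_lower K0.
have v00 : 0 < v 0 ^+ 2 by rewrite exprn_gt0.
pose l0 := lam K0.+1; have l00 : 0 <= l0.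
  by apply: mulr_ge0 => //; exact: addr_ge0.
have i16 : 0 < 1 / (16 * beta) by rewrite divr_gt0// mulr_gt0.
have [Ca Ca0 HCa] := christoffel_ratio_oscillatory c0 c (1 / 4) C1 (1 / (16 * beta)) Cv
  c0_ge0 c_gt0 ltac:(lra) C10 i16 (ltW Cv0).
have e0 : 0 <= 4 * Ms * l0 / beta.
  by apply: divr_ge0; [apply: mulr_ge0 => //; exact: mulr_ge0|exact: ltW].
have e1 : 0 < v 0 ^+ 2 / K0.+1%:R by rewrite divr_gt0.
have e2 : 0 < d / 2 by rewrite divr_gt0.
have [Cb Cb0 HCb] := christoffel_ratio_oscillatory c0 c (d / 2) (4 * Ms * l0 / beta)
  (v 0 ^+ 2 / K0.+1%:R) Ms c0_ge0 c_gt0 e2 e0 e1 Ms0.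
pose Cc := 16 * beta * Cv; pose Cd := K0.+1%:R * Ms / v 0 ^+ 2.
have Cc0 : 0 <= Cc by rewrite /Cc !mulr_ge0// ltW.
have Cd0 : 0 <= Cd by rewrite /Cd divr_ge0 ?mulr_ge0// ltW.
pose C := Ca + Cb + Cc + Cd.
have [CCa CCb CCc CCd] : [/\ Ca <= C, Cb <= C, Cc <= C & Cd <= C].
  by rewrite /C; move: Ca0 Cb0 Cc0 Cd0; move: Ca Cb Cc Cd {HCa HCb C} => *; split; lra.
have C0 : 0 <= C by exact: le_trans CCa.
exists C => // t t0 t1 n k kn.
set S := \sum_(j < n.+1) f t j ^+ 2.
have S0 : 0 <= S by apply: sumr_ge0 => j _; exact: sqr_ge0.
have bigger C' : C' <= C -> n.+1%:R * f t k ^+ 2 <= C' * S ->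
    n.+1%:R * f t k ^+ 2 <= C * S.
  by move=> CC /le_trans; apply; rewrite ler_wpM2r.
have sq_le m j : (j <= m)%N -> t * lam m <= beta -> f t j ^+ 2 <= Cv * v m ^+ 2.
  move=> jm tm; have tj : t * lam j <= beta.
    by apply: le_trans tm; rewrite ler_wpM2l// lam_homo.
  apply: le_trans (vmono j m jm).
  have /andP[_ h] := near_endpoint t j t0 tj.
  have h' : 0 <= f t j.
    by apply: le_trans (near_endpoint_ge t j t0 tj); rewrite divr_ge0// ltW.
  by rewrite ler_sqr ?nnegrE// (le_trans h').
have [tn|tn] := leP (t * lam n) beta.
  apply: (bigger _ CCc).
  apply: (@le_trans _ _ (n.+1%:R * (Cv * v n ^+ 2))); first by rewrite ler_wpM2l// sq_le.
  rewrite mulrCA /Cc mulrAC [leRHS]mulrC ler_wpM2l ?(ltW Cv0)//.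
  exact: near_endpoint_sum.
have tp : 0 < t.
  by rewrite lt_neqAle t0 andbT; apply: contraTneq tn => <-; rewrite mul0r -leNgt ltW.
have ex : exists m, ~~ (t * lam m <= beta) by exists n; rewrite -ltNge.
case: (ex_minnP ex) => -[|m]; first by rewrite mul0r mulr0 ltW.
rewrite -ltNge => mbig mmin.
have msmall : t * lam m <= beta.
  by apply/negPn/negP => /mmin; rewrite ltnn.
have mn : (m < n)%N by apply: mmin; rewrite -ltNge.
(* If m <= K0 then t > beta / l0, so the oscillatory lemma starts at the fixed index [K0] with scale
   1, [consecutive_lower] bounding the energy below; n <= K0 needs only the crude bounds [M]. *)
have [mK|Km] := leqP m K0.
  have tK0 : beta < t * l0.
    by apply: lt_le_trans mbig _; rewrite ler_wpM2l// lam_homo.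
  have [nK|/ltnW Kn] := leqP n K0.
    apply: (bigger _ CCd).
    apply: (@le_trans _ _ (K0.+1%:R * Ms)).
      apply: ler_pM => //; first exact: sqr_ge0.
        by rewrite ler_nat.
      by apply: fM => //; apply: leq_trans kn (leq_trans nK _).
    have -> : Cd * S = K0.+1%:R * Ms * (S / v 0 ^+ 2) by rewrite /Cd; ring.
    rewrite ler_peMr ?mulr_ge0// ler_pdivlMr// mul1r /S big_ord_recl /= f0 lerDl.
    by apply: sumr_ge0 => j _; exact: sqr_ge0.
  apply: (bigger _ CCb).
  apply: (HCb a b (f t) t 1 K0) => //.
  - apply: cK => //; apply: lt_le_trans tK0 _; rewrite ler_wpM2l// lam_homo//.
  - have -> : d / 2 * t * 1 = t * d / 2 by ring.
    rewrite ler_pdivrMr// [leRHS]mulrC.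
    apply: le_trans (energy_ge_pair R (f t) t tp t1 K0).
    by rewrite ler_wpM2l// dlow.
  - have h1 := fM t K0 t0 t1 (leqnSn _); have h2 := fM t K0.+1 t0 t1 (leqnn _).
    have h3 : energy R (f t) t K0 <= 4 * Ms.
      apply: le_trans (energy_le_pair R (f t) t tp t1 K0) _.
      have -> : 4 * Ms = 2 * (Ms + Ms) by ring.
      by rewrite ler_pM2l// lerD.
    apply: (le_trans h3); rewrite mulr1.
    have -> : 4 * Ms * l0 / beta * t = 4 * Ms * (t * l0 / beta) by ring.
    by rewrite ler_peMr ?mulr_ge0// ler_pdivlMr// mul1r ltW.
  - rewrite mulr1 divfK ?pnatr_eq0// big_ord_recl /= f0 lerDl.
    by apply: sumr_ge0 => j _; exact: sqr_ge0.
  - by move=> j jK; rewrite mulr1 fM//; exact: leqW.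
(* One step back from the last index m of the monotone range: the energy at K = m - 1 involves f_K
   and f_(K+1) = f_m, both controlled by the values at 1. *)
case: m => [//|K] in Km mbig msmall mn mmin *.
have K1 : (1 <= K)%N by move: Km; rewrite ltnS; exact: leq_trans.
have c1K : c <= K%:R * Num.sqrt t by exact: cK.
apply: (bigger _ CCa).
have tK : t * lam K <= beta.
  by apply: le_trans msmall; rewrite ler_wpM2l// lam_homo.
apply: (HCa a b (f t) t (v K ^+ 2) K) => //.
- by apply: le_trans K0_large _; rewrite ler_nat ltnS.
- exact: sqr_ge0.
- apply: le_trans (energy_geL R (f t) t tp t1 K).
  have -> : 1 / 4 * t * v K ^+ 2 = t * (v K ^+ 2 / 4) by ring.
  rewrite ler_wpM2l//.
  exact: sqr_half_le (ltW (v_gt0 K)) (near_endpoint_ge t K t0 tK).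
- exact: trans.
- have := near_endpoint_sum t K t0 tK.
  have -> : 1 / (16 * beta) * K.+1%:R * v K ^+ 2 = K.+1%:R * v K ^+ 2 / (16 * beta) by ring.
  by rewrite ler_pdivrMr ?mulr_gt0// [leRHS]mulrC.
- by move=> j jK; exact: sq_le.
- by apply: leq_trans (ltnW mn); exact: leqnSn.
Qed.
End ChristoffelRatio.

(** * From orthonormal polynomials to the recurrence data *)

Section JacobiPolynomials.
Variables (R : realType) (alpha beta : R).
Local Notation s := (alpha + beta - 1).
Hypotheses (halpha : 1 / 2 <= alpha) (hbeta : 1 / 2 <= beta).

(** Abstracts the integral so that the reflected functional, with the exponents exchanged, is again
    an instance. *)
Definition pearson_functional (a b : R) (l : {poly R} -> R) :=
  (forall c p q, l (c *: p + q) = c * l p + l q) /\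
  (forall r, l (((a - b)%:P - (a + b) *: 'X) * r + (1 - 'X ^+ 2) * r^`()) = 0).

Definition orthonormal_for (l : {poly R} -> R) (phi : nat -> {poly R}) :=
  (forall k, size (phi k) = k.+1) /\
  (forall i j, l (phi i * phi j) = (i == j)%:R).

Section Relations.
Variables (l : {poly R} -> R) (phi : nat -> {poly R}).
Hypotheses (hl : pearson_functional alpha beta l) (hphi : orthonormal_for l phi).

Local Notation a := (jacobi_offdiag R l phi).
Local Notation b := (jacobi_diag R l phi).
Local Notation v k := ((phi k).[1]).

Let eigen k : jacobi_operator R alpha beta (phi k)
  = - (k%:R * (k%:R + s)) *: phi k.
Proof.
have [lin pea] := hl; have [sz ort] := hphi.
rewrite (jacobi_operator_eigen R alpha beta l phi lin sz ort pea k).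
by rewrite !addrA.
Qed.

Let eigenS k : jacobi_operator R alpha beta (phi k.+1)
  = - ((k%:R + 1) * (k%:R + 1 + s)) *: phi k.+1.
Proof. by rewrite eigen natr1. Qed.

Lemma recurrence0 z : z * (phi 0).[z] = a 0 * (phi 1).[z] + b 0 * (phi 0).[z].
Proof.
have [lin _] := hl; have [sz ort] := hphi.
have := congr1 (horner^~ z) (three_term0 R l phi lin sz ort).
by rewrite /= hornerM hornerX hornerD !hornerZ.
Qed.

Lemma recurrenceS z k : z * (phi k.+1).[z] =
  a k.+1 * (phi k.+2).[z] + b k.+1 * (phi k.+1).[z] + a k * (phi k).[z].
Proof.
have [lin _] := hl; have [sz ort] := hphi.
have := congr1 (horner^~ z) (three_termS R l phi lin sz ort k).
by rewrite /= hornerM hornerX !hornerD !hornerZ.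
Qed.

Let relation0 : a 0 * (1 + s) * v 1 = 2 * beta * v 0 /\
  a 0 * (1 + s) * (2 * s) * v 1 = 4 * s * beta * v 0.
Proof.
have [lin _] := hl; have [sz ort] := hphi.
(* The zero polynomial stands for degree -1, which makes [endpoint_recurrence] available at x =
   0. *)
have L0 : jacobi_operator R alpha beta 0 = - ((0 - 1) * (0 - 1 + s)) *: 0.
  by rewrite /jacobi_operator !derivC !mulr0 addr0 scaler0.
have L1 : jacobi_operator R alpha beta (phi 1) = - ((0 + 1) * (0 + 1 + s)) *: phi 1.
  exact: eigenS.
have [|h1 h2] := endpoint_recurrence R alpha beta _ _ _ (a 0) (b 0) 0 0 (eigen 0) L1 L0.
  by rewrite (three_term0 R l phi lin sz ort) scaler0 addr0.
split; first by rewrite -h1; ring.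
by move: h2; rewrite !mulr0 !add0r.
Qed.

Let relationS k :
  a k.+1 * (2 * k%:R + 3 + s) * v k.+2 - a k * (2 * k%:R + 1 + s) * v k
    = 2 * beta * v k.+1 /\
  a k.+1 * (2 * (k%:R + 1) + 1 + s) * (4 * (k%:R + 1) + 2 * s) * v k.+2
    = 4 * (k%:R + 1 + s) * (k%:R + 1 + beta) * v k.+1.
Proof.
have [lin _] := hl; have [sz ort] := hphi.
have L2 : jacobi_operator R alpha beta (phi k.+2) =
    - ((k%:R + 1 + 1) * (k%:R + 1 + 1 + s)) *: phi k.+2.
  by rewrite eigenS -(natr1 k).
have L0 : jacobi_operator R alpha beta (phi k) =
    - ((k%:R + 1 - 1) * (k%:R + 1 - 1 + s)) *: phi k.
  by rewrite eigen addrK.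
have [h1 h2] := endpoint_recurrence R alpha beta _ _ _ _ _ _ _ (eigenS k) L2 L0
  (three_termS R l phi lin sz ort k).
by split => //; rewrite -h1; ring.
Qed.

Lemma endpoint_slope0 : a 0 * (1 + s) * v 1 = 2 * beta * v 0.
Proof. exact: relation0.1. Qed.

Lemma endpoint_slopeS k :
  a k.+1 * (2 * k%:R + 3 + s) * v k.+2 - a k * (2 * k%:R + 1 + s) * v k
    = 2 * beta * v k.+1.
Proof. exact: (relationS k).1. Qed.

Lemma endpoint_ratio k :
  a k * (2 * k%:R + 1 + s) * (2 * k%:R + s) * v k.+1
  = 2 * (k%:R + s) * (k%:R + beta) * v k.
Proof.
have two0 : 2 != 0 :> R by rewrite pnatr_eq0.
apply: (mulfI two0); case: k => [|k].
  have h := relation0.2.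
  transitivity (a 0 * (1 + s) * (2 * s) * v 1); first by ring.
  by rewrite h; ring.
have h := (relationS k).2; rewrite -(natr1 k).
transitivity (a k.+1 * (2 * (k%:R + 1) + 1 + s) * (4 * (k%:R + 1) + 2 * s) * v k.+2).
  by ring.
by rewrite h; ring.
Qed.

(** A zero of v propagates down to the constant [phi 0]; the last step uses [endpoint_slope0], since
    [endpoint_ratio] may degenerate at index 0. *)
Lemma endpoint_neq0 k : v k != 0.
Proof.
have ha := halpha; have hb := hbeta; have b0 : beta != 0 by rewrite gt_eqF//; lra.
elim: k => [|k IH].
  have /size_poly1P[c c0 ->] : size (phi 0) == 1 by rewrite hphi.1.
  by rewrite hornerC.
apply: contra IH => /eqP v0; case: k => [|k] in v0 *.
  have /esym/eqP := endpoint_slope0.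
  by rewrite v0 mulr0 mulf_eq0 mulf_eq0 pnatr_eq0 (negPf b0).
have /esym/eqP := endpoint_ratio k.+1.
rewrite v0 mulr0 !mulf_eq0 pnatr_eq0 /= => /orP[/orP[]|//]; rewrite gt_eqF//.
  have : 0 < k.+1%:R :> R by []. lra.
have : 0 < k.+1%:R :> R by []. lra.
Qed.
End Relations.

Lemma christoffel_ratio_right (l : {poly R} -> R) (phi : nat -> {poly R}) :
  pearson_functional alpha beta l -> orthonormal_for l phi ->
  exists2 C : R, 0 <= C & forall z, 0 <= z -> z <= 1 -> forall n k, (k <= n)%N ->
    n.+1%:R * (phi k).[z] ^+ 2 <= C * \sum_(j < n.+1) (phi j).[z] ^+ 2.
Proof.
move=> hl hphi; have vn0 := endpoint_neq0 l phi hl hphi.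
(* Signs are chosen so that the values at 1 are positive; squares do not change. *)
pose psi k := Num.sg (phi k).[1] *: phi k.
have hpsi : orthonormal_for l psi.
  have [sz ort] := hphi; split=> [k|i j].
    by rewrite size_scale ?sgr_eq0.
  have Z := functionalZ R l hl.1.
  rewrite -scalerAl -scalerAr !Z ort; have [->|ij] := eqVneq i j; last by rewrite !mulr0.
  by rewrite mulr1 -expr2 sqr_sg vn0.
have v0 k : 0 < (psi k).[1].
  by rewrite hornerZ -normrEsg normr_gt0.
have sq k z : (psi k).[z] ^+ 2 = (phi k).[z] ^+ 2.
  by rewrite hornerZ exprMn sqr_sg vn0 mul1r.
pose f t k := (psi k).[1 - t].
have f0 t : f t 0 = (psi 0).[1].
  have /size_poly1P[c _ e] : size (psi 0) == 1 by rewrite hpsi.1.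
  by rewrite /f e !hornerC.
pose M k := (\sum_(i < size (psi k)) `|(psi k)`_i|) ^+ 2.
have fM t k : 0 <= t -> t <= 1 -> f t k ^+ 2 <= M k.
  move=> t0 t1; rewrite -real_normK ?num_real// ler_sqr ?nnegrE ?sumr_ge0//.
  by apply: horner_norm_le; rewrite ger0_norm; lra.
have val0 : (psi 0).[1] = jacobi_offdiag R l psi 0 * (psi 1).[1]
    + jacobi_diag R l psi 0 * (psi 0).[1].
  by rewrite -(recurrence0 l psi hl hpsi) mul1r.
have val k : (psi k.+1).[1] = jacobi_offdiag R l psi k.+1 * (psi k.+2).[1]
    + jacobi_diag R l psi k.+1 * (psi k.+1).[1] + jacobi_offdiag R l psi k * (psi k).[1].
  by rewrite -(recurrenceS l psi hl hpsi) mul1r.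
have [C C0 HC] := christoffel_ratio_le R alpha beta (jacobi_offdiag R l psi)
  (jacobi_diag R l psi) (fun k => (psi k).[1]) f halpha hbeta v0
  (endpoint_slope0 l psi hl hpsi) (endpoint_slopeS l psi hl hpsi)
  (endpoint_ratio l psi hl hpsi) val0 val f0
  (fun t => recurrence0 l psi hl hpsi (1 - t))
  (fun t => recurrenceS l psi hl hpsi (1 - t)) M fM.
exists C => // z z0 z1 n k kn.
have := HC (1 - z); rewrite subr_ge0 z1 gerBl z0 => /(_ isT isT n k kn).
rewrite /f subKr sq => /le_trans; apply; rewrite ler_wpM2l//.
by apply: ler_sum => j _; rewrite sq.
Qed.

End JacobiPolynomials.

(** * Reflection and the whole interval *)

Lemma reflection_comp {R : comNzRingType} (p : {poly R}) : (p \Po - 'X) \Po - 'X = p.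
Proof.
have e : - 'X = -1 *: 'X :> {poly R} by rewrite scaleN1r.
have XX : - 'X \Po - 'X = 'X :> {poly R}.
  by rewrite [X in X \Po _]e comp_polyZ comp_polyX scaleN1r opprK.
by rewrite -comp_polyA XX comp_polyXr.
Qed.

Lemma pearson_reflection {R : realType} (alpha beta : R) (l : {poly R} -> R) :
  pearson_functional R alpha beta l ->
  pearson_functional R beta alpha (fun p => l (p \Po - 'X)).
Proof.
move=> [lin pea]; split=> [c p q|r]; first by rewrite comp_polyD comp_polyZ lin.
have := pea (r \Po - 'X); rewrite deriv_comp derivN derivX.
have N p : l (- p) = - l p by rewrite -scaleN1r (functionalZ R l lin) mulN1r.
move=> /eqP; rewrite -oppr_eq0 -N => /eqP <-; congr (l _).
rewrite comp_polyD !comp_polyM !comp_polyB comp_polyZ comp_polyX comp_polyC.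
have c1 : 1 \Po - 'X = 1 :> {poly R} by rewrite -polyC1 comp_polyC.
rewrite comp_Xn_poly c1 -!mul_polyC !polyCB !polyCD.
by ring.
Qed.

Lemma orthonormal_reflection {R : realType} (l : {poly R} -> R) (phi : nat -> {poly R}) :
  orthonormal_for R l phi ->
  orthonormal_for R (fun p => l (p \Po - 'X)) (fun k => phi k \Po - 'X).
Proof.
move=> [sz ort]; split=> [k|i j].
  by rewrite size_comp_poly2 ?size_polyN ?size_polyX.
by rewrite -comp_polyM reflection_comp.
Qed.

Lemma christoffel_ratio_bounded {R : realType} (alpha beta : R)
    (l : {poly R} -> R) (phi : nat -> {poly R}) :
  1 / 2 <= alpha -> 1 / 2 <= beta ->
  pearson_functional R alpha beta l -> orthonormal_for R l phi ->
  exists2 C : R, 0 <= C & forall z, -1 <= z -> z <= 1 -> forall n k, (k <= n)%N ->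
    n.+1%:R * (phi k).[z] ^+ 2 <= C * \sum_(j < n.+1) (phi j).[z] ^+ 2.
Proof.
move=> ha hb hl hphi.
have [C C0 HC] := christoffel_ratio_right R alpha beta ha hb l phi hl hphi.
have [C' C'0 HC'] := christoffel_ratio_right R beta alpha hb ha _ _
  (pearson_reflection alpha beta l hl) (orthonormal_reflection l phi hphi).
exists (C + C') => [|z zm z1 n k kn]; first exact: addr_ge0.
have S0 : 0 <= \sum_(j < n.+1) (phi j).[z] ^+ 2 by apply: sumr_ge0 => j _; exact: sqr_ge0.
have [z0|z0] := leP 0 z.
  by apply: le_trans (HC z z0 z1 n k kn) _; rewrite ler_wpM2r// lerDl.
have E j : (phi j \Po - 'X).[- z] = (phi j).[z] by rewrite horner_comp hornerN hornerX opprK.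
have nz0 : 0 <= - z by lra.
have nz1 : - z <= 1 by lra.
have := HC' (- z) nz0 nz1 n k kn; rewrite E (eq_bigr (fun j => (phi (nat_of_ord j)).[z] ^+ 2)).
  by move=> /le_trans; apply; rewrite ler_wpM2r// lerDr.
by move=> j _; rewrite E.
Qed.

Theorem theorem5p1 (R : realType) (alpha beta : R)
    (halpha : 1 / 2 <= alpha) (hbeta : 1 / 2 <= beta)
    (phi : nat -> {poly R})
    (hphi : orthonormal_polys (jacobi_weight alpha beta) phi) :
  exists C : R, forall n : nat, (1 <= n)%N -> (Lmax phi n <= C%:E)%E.
Proof.
have a0 : 0 < alpha by lra.
have b0 : 0 < beta by lra.
have iw := integrable_jacobi_weight R alpha beta phi hphi.
have hl : pearson_functional R alpha beta (jacobi_functional R alpha beta).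
  split; first exact: jacobi_functional_linear.
  exact: jacobi_functional_pearson.
have ho : orthonormal_for R (jacobi_functional R alpha beta) phi.
  split=> [|i j]; first exact: hphi.1.
  rewrite /jacobi_functional /Rintegral.
  by under eq_integral => z _ do rewrite hornerM; rewrite hphi.2.
have [C C0 HC] := christoffel_ratio_bounded alpha beta _ phi halpha hbeta hl ho.
exists C => n _; rewrite /Lmax; apply: bigmax_le => [|k _]; first exact: leNye.
apply: ge_ereal_sup => y [z /=]; rewrite in_itv/= => /andP[zm z1] <-.
rewrite lee_fin /christoffel.
have S0 : 0 <= \sum_(j < n.+1) (phi j).[z] ^+ 2 by apply: sumr_ge0 => j _; exact: sqr_ge0.
(* For a zero sum the inverse is 0 by convention, and C >= 0 suffices. *)
rewrite mulrAC mulrA mulr1; move: S0; rewrite le_eqVlt => /predU1P[<-|S0].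
  by rewrite invr0 mulr0.
by rewrite ler_pdivrMr// HC// -ltnS.
Qed.
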